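(* Let $m,n$ be integers with $1\le m<\frac{n}{2}$, and let $-2m<a<+\infty$, $0<p<\frac{n+2m+2a}{n-2m}$. If $u\in C(\mathbb{R}^{n})$ is a nonnegative solution of the integral equation $$u(x)=\int_{\mathbb{R}^{n}}\frac{C_{n,m}}{|x-y|^{n-2m}}|y|^{a}u^{p}(y)\,dy,\qquad x\in\mathbb{R}^{n},$$ then $u\equiv0$ in $\mathbb{R}^{n}$.
   Context: $C_{n,m}>0$ is the normalizing constant, depending only on $n$ and $m$, for which $C_{n,m}|x|^{2m-n}$ is the fundamental solution of $(-\Delta)^{m}$ in $\mathbb{R}^{n}$. *)

(* Defs.v *)
From HB Require Import structures.
From mathcomp Require Import all_boot all_order all_algebra.
From mathcomp Require Import all_classical all_reals all_analysis.
Set Implicit Arguments.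
Unset Strict Implicit.
Unset Printing Implicit Defensive.
Import Order.TTheory GRing.Theory Num.Theory.
Import numFieldNormedType.Exports.
Local Open Scope classical_set_scope.
Local Open Scope ring_scope.

(* R^n is 'rV[R]_n. Its library norm is the sup norm, which has the same
   topology as [enorm] but must not be used for |x|. *)
Definition enorm (R : realType) (n : nat) (x : 'rV[R]_n) : R :=
  Num.sqrt (\sum_(i < n) x ord0 i ^+ 2).

Definition measure_rV_display : measure_display -> measure_display.
Proof. exact. Qed.

(* The product sigma-algebra, generated by the coordinates; over the reals it
   is the Borel sigma-algebra. *)
Section measurable_rV.
Context {d} {T : measurableType d}.
Variable n : nat.

Definition rV_coord (i : 'I_n) (x : 'rV[T]_n) : T := x ord0 i.

Let rV_set0 : g_sigma_preimage rV_coord set0.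
Proof. exact: sigma_algebra0. Qed.

Let rV_setC A : g_sigma_preimage rV_coord A -> g_sigma_preimage rV_coord (~` A).
Proof. exact: sigma_algebraC. Qed.

Let rV_bigcup (F : _^nat) : (forall i, g_sigma_preimage rV_coord (F i)) ->
  g_sigma_preimage rV_coord (\bigcup_i (F i)).
Proof. exact: sigma_algebra_bigcup. Qed.

HB.instance Definition _ := @isMeasurable.Build (measure_rV_display d)
  ('rV[T]_n) (g_sigma_preimage rV_coord) rV_set0 rV_setC rV_bigcup.

Lemma measurable_rV_coord (i : 'I_n) : measurable_fun [set: 'rV[T]_n] (rV_coord i).
Proof.
move=> _ Y mY; rewrite setTI; apply: sub_sigma_algebra => /=.
rewrite -bigcup_seq/=; exists i => /=; first by rewrite mem_index_enum.
by exists Y => //; rewrite setTI.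
Qed.

Lemma measurable_fun_rVP d' (S : measurableType d') (f : S -> 'rV[T]_n) :
  (forall i, measurable_fun [set: S] (rV_coord i \o f)) ->
  measurable_fun [set: S] f.
Proof.
move=> mf _ A mA; rewrite setTI.
suff /(_ _ mA) : @measurable _ 'rV[T]_n `<=` [set A | measurable (f @^-1` A)] by [].
apply: smallest_sub => /=.
  split => /=.
  - by rewrite preimage_set0.
  - by move=> B mB; rewrite setTD preimage_setC; exact: measurableC.
  - by move=> F mF; rewrite preimage_bigcup; exact: bigcup_measurable.
rewrite -bigcup_seq => B [/= i _ [C mC <-]].
by rewrite setTI -comp_preimage -[X in measurable X]setTI; exact: mf.
Qed.

End measurable_rV.

(* Lebesgue measure on R^n as an iterated product, by transporting
   lebesgue_measure \x mu along R * R^n -> R^(1 + n). *)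
Section lebesgue_rV.
Variable R : realType.

Section cons_rV.
Variable n : nat.

Definition cons_rV (x : measurableTypeR R * 'rV[R]_n) : 'rV[R]_n.+1 :=
  \row_i (if unlift ord0 i is Some j then x.2 ord0 j else x.1).

Definition uncons_rV (x : 'rV[R]_n.+1) : measurableTypeR R * 'rV[R]_n :=
  (x ord0 ord0, \row_j x ord0 (lift ord0 j)).

Lemma cons_rV0 x : cons_rV x ord0 ord0 = x.1.
Proof. by rewrite mxE unlift_none. Qed.

Lemma cons_rVS x j : cons_rV x ord0 (lift ord0 j) = x.2 ord0 j.
Proof. by rewrite mxE liftK. Qed.

Lemma cons_rVK : cancel cons_rV uncons_rV.
Proof.
case=> x y; rewrite /uncons_rV cons_rV0; congr pair.
by apply/rowP => j; rewrite mxE cons_rVS.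
Qed.

Lemma measurable_cons_rV : measurable_fun [set: _] cons_rV.
Proof.
apply: measurable_fun_rVP => i; case: (unliftP ord0 i) => [j ->|->].
- rewrite (_ : _ \o _ = rV_coord j \o snd); last first.
    by apply/funext => x; exact: cons_rVS.
  by apply: measurableT_comp => //; exact: measurable_rV_coord.
- rewrite (_ : _ \o _ = fst) //; by apply/funext => x; exact: cons_rV0.
Qed.

Lemma measurable_uncons_rV : measurable_fun [set: _] uncons_rV.
Proof.
apply/measurable_fun_pairP; split; first exact: (@measurable_rV_coord _ R _ ord0).
apply: measurable_fun_rVP => i.
rewrite (_ : _ \o _ = rV_coord (lift ord0 i)); first exact: measurable_rV_coord.
by apply/funext => x; rewrite /rV_coord /= mxE.
Qed.

Variable mu : {sigma_finite_measure set 'rV[R]_n -> \bar R}.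

Definition cons_measure : set 'rV[R]_n.+1 -> \bar R :=
  pushforward (lebesgue_measure \x mu)%E cons_rV.

Let cons_measure0 : cons_measure set0 = 0%E.
Proof. by rewrite /cons_measure /pushforward preimage_set0 measure0. Qed.

Let cons_measure_ge0 A : (0 <= cons_measure A)%E.
Proof. exact: integral_ge0. Qed.

Let cons_measure_sigma_additive : semi_sigma_additive cons_measure.
Proof.
move=> F mF tF mUF; rewrite /cons_measure /pushforward preimage_bigcup.
apply: measure_semi_sigma_additive.
- by move=> k; rewrite -[X in measurable X]setTI; exact: measurable_cons_rV.
- apply/trivIsetP => /= i j _ _ ij; rewrite -preimage_setI.
  by move/trivIsetP : tF => /(_ _ _ _ _ ij) ->//; rewrite preimage_set0.
- by rewrite -preimage_bigcup -[X in measurable X]setTI; exact: measurable_cons_rV.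
Qed.

HB.instance Definition _ := isMeasure.Build _ _ _ cons_measure
  cons_measure0 cons_measure_ge0 cons_measure_sigma_additive.

Let cons_measure_sigma_finite : sigma_finite setT cons_measure.
Proof.
have /sigma_finiteP[F [TF ndF Foo]] := sigma_finiteT (@lebesgue_measure R).
have /sigma_finiteP[G [TG ndG Goo]] := sigma_finiteT mu.
exists (fun k => uncons_rV @^-1` (F k `*` G k)).
  apply/esym; rewrite -subTset => x _; set y := uncons_rV x.
  have [k _ Fk] : (\bigcup_k F k) y.1 by rewrite -TF.
  have [l _ Gl] : (\bigcup_k G k) y.2 by rewrite -TG.
  exists (maxn k l) => //; split.
  - by move: (y.1) Fk; exact/subsetPset/ndF/leq_maxl.
  - by move: (y.2) Gl; exact/subsetPset/ndG/leq_maxr.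
move=> k; have [mF Fk] := Foo k; have [mG Gk] := Goo k; split.
  rewrite -[X in measurable X]setTI.
  by apply: measurable_uncons_rV => //; exact: measurableX.
rewrite /cons_measure /pushforward -comp_preimage.
rewrite (_ : _ \o _ = id) ?preimage_id; last by apply/funext; exact: cons_rVK.
by rewrite product_measure1E// lte_mul_pinfty// ge0_fin_numE.
Qed.

HB.instance Definition _ := Measure_isSigmaFinite.Build _ _ _ cons_measure
  cons_measure_sigma_finite.

End cons_rV.

Fixpoint lebesgue_rV (n : nat) : {sigma_finite_measure set 'rV[R]_n -> \bar R} :=
  match n with
  | 0 => dirac (0 : 'rV[R]_0)
  | k.+1 => cons_measure (lebesgue_rV k)
  end.

End lebesgue_rV.
Arguments lebesgue_rV R n : clear implicits.

Section fundamental_solution.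
Context {R : realType} {n : nat}.
Implicit Types (f phi : 'rV[R]_n -> R) (i : 'I_n).

Definition partial i f : 'rV[R]_n -> R := 'D_(delta_mx 0 i) f.

Fixpoint of_class_C (k : nat) f : Prop :=
  continuous f /\
  (if k is l.+1 then
     forall i, (forall x, derivable f x (delta_mx 0 i)) /\
               of_class_C l (partial i f)
   else True).

Definition test_function phi : Prop :=
  (forall k, of_class_C k phi) /\ compact (closure [set x | phi x != 0]).

Definition minus_laplacian f : 'rV[R]_n -> R :=
  fun x => - \sum_(i < n) partial i (partial i f) x.

(* (-Delta)^m E = delta_0 in the sense of distributions. *)
Definition is_fundamental_solution (m : nat) (E : 'rV[R]_n -> R) : Prop :=
  (forall K : set 'rV[R]_n, compact K ->
     (lebesgue_rV R n).-integrable K (EFin \o E)) /\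
  (forall phi, test_function phi ->
     (\int[lebesgue_rV R n]_x (E x * iter m minus_laplacian phi x)%:E
      = (phi 0)%:E)%E).

End fundamental_solution.

(* C is the constant C_{n,m}; the value of x ^- k at 0 is irrelevant, being
   taken on a null set. *)
Definition is_normalizing_constant (R : realType) (n m : nat) (C : R) : Prop :=
  0 < C /\
  is_fundamental_solution m (fun x : 'rV[R]_n => C * enorm x ^- (n - 2 * m)).

(* Main.v *)
(* Method of scaling spheres. Suppose u does not vanish; then u > 0. For l > 0
   let u_l(x) = (l/|x|)^(n-2m) u(l^2 x/|x|^2). Folding the exterior of the ball
   B_l onto B_l by inversion gives
     u_l(x) - u(x) = int_{B_l} (K(x,y) - K_l(x,y)) (g_l(y) - |y|^a u(y)^p) dy
   with K >= K_l and g_l = (l/|y|)^tau |y|^a u_l^p, where tau > 0 because p is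
   subcritical. Let p > 1. If u - u_l <= S in B_l and {u_l < u} lies in a region
   where int K(x,y)|y|^a dy is small, this identity gives u - u_l <= S/2, hence
   u <= u_l. That settles small l. If u <= u_l in B_l, then u_l - u is bounded
   below by a positive constant away from the sphere, and
   u_l'(x) = s^(n-2m) u_l(s^2 x) with s = l/l' transfers this to l' > l close to
   l, leaving only a thin annulus, which is small. So u <= u_l in B_l for every
   l, which yields u(x) >= c |x|^(-(n-2m)/2) for |x| >= 1. On the other hand the
   minimum v of u over the ball of radius R satisfies v >= c R^(2m+a) v^p, which
   contradicts this lower bound as R tends to infinity; for p <= 1 it already
   contradicts v <= u(0).

   The Jacobian of the inversion is obtained without polar coordinates: the
   measure dy/|y|^n is dilation invariant, and averaging over dilations reduces
   its invariance under inversion to that of Lebesgue measure on R under s |-> -s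
   and translations. *)
From HB Require Import structures.
Require Import Defs.
From mathcomp Require Import all_boot all_order all_algebra.
From mathcomp Require Import all_classical all_reals all_analysis.
From mathcomp Require Import measurable_realfun ring lra.
Import Order.TTheory GRing.Theory Num.Theory.
Import numFieldNormedType.Exports.
Local Open Scope classical_set_scope.
Local Open Scope ring_scope.
Set Implicit Arguments.
Unset Strict Implicit.
Unset Printing Implicit Defensive.

(** * Lebesgue measure on R^n *)

Section lebesgue_measure_affine.
Context {R : realType}.
Local Notation mu := (@lebesgue_measure R).

Let aff (c b : R) (s : measurableTypeR R) : measurableTypeR R := c * s + b.

Let maff c b : measurable_fun setT (aff c b).
Proof. by apply: measurable_funD => //; exact: measurable_funM. Qed.

(** Both sides are measures of [A]. They agree on the intervals []x, y]], and these determine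
    Lebesgue measure. *)
Lemma lebesgue_measure_affine (c b : R) (A : set R) : 0 < c -> measurable A ->
  mu A = (c%:E * mu ((fun s => c * s + b)%R @^-1` A))%E.
Proof.
move=> c0 mA.
pose pf : {measure set (measurableTypeR R) -> \bar R} :=
  measure_function_pushforward__canonical__measure_function_Measure mu
    (maff c b).
pose nu := mscale (NngNum (ltW c0)) pf.
have -> : (c%:E * mu ((fun s => c * s + b)%R @^-1` A))%E = nu A by [].
apply: lebesgue_measure_unique => //= _ [[x y]] _ <-.
rewrite /nu /mscale /= /pushforward /=.
have -> : aff c b @^-1` `]x, y] = `]((x - b) / c), ((y - b) / c)]%classic.
  apply/seteqP; split=> s /=; rewrite !in_itv /= /aff => /andP[h1 h2].
    by rewrite ltr_pdivrMr// ler_pdivlMr//; apply/andP; split; lra.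
  by move: h1 h2; rewrite ltr_pdivrMr// ler_pdivlMr// => h1 h2; apply/andP; split; lra.
rewrite !lebesgue_measure_itv/= !lte_fin ltr_pM2r ?invr_gt0// ltrD2r.
case: ifP => _; last by rewrite mule0.
rewrite -!EFinD -EFinM; congr (_%:E); field; lra.
Qed.

Lemma ge0_integral_affine (c b : R) (g : R -> \bar R) : 0 < c ->
  measurable_fun [set: R] g -> (forall s, 0 <= g s)%E ->
  (\int[mu]_s g s = c%:E * \int[mu]_s g (c * s + b)%R)%E.
Proof.
move=> c0 mg g0.
pose pf : {measure set (measurableTypeR R) -> \bar R} :=
  measure_function_pushforward__canonical__measure_function_Measure mu
    (maff c b).
have -> : (\int[mu]_s g (c * s + b)%R = \int[pf]_s g s)%E.
  by rewrite (ge0_integral_pushforward (maff c b)).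
have -> : (c%:E = (NngNum (ltW c0))%:num%:E)%E by [].
rewrite -ge0_integral_mscale//.
apply: eq_measure_integral => A mA _.
exact: lebesgue_measure_affine.
Qed.

Lemma ge0_integral_opp (g : R -> \bar R) :
  measurable_fun [set: R] g -> (forall s, 0 <= g s)%E ->
  (\int[mu]_s g s = \int[mu]_s g (- s)%R)%E.
Proof.
move=> mg g0.
pose N : measurableTypeR R -> measurableTypeR R := -%R.
have mN : measurable_fun setT N by exact: oppr_measurable.
have -> : (\int[mu]_s g (- s)%R = \int[pushforward mu N]_s g s)%E.
  by rewrite (ge0_integral_pushforward mN).
pose pN : {measure set (measurableTypeR R) -> \bar R} :=
  measure_function_pushforward__canonical__measure_function_Measure mu mN.
rewrite -[RHS]/(\int[pN]_s g s)%E.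
by apply: eq_measure_integral => A mA _; exact/esym/lebesgue_measureN.
Qed.

End lebesgue_measure_affine.

Section lebesgue_rV_affine.
Context {R : realType}.
Local Notation mu := (@lebesgue_measure R).

Lemma measurable_affine_rV n (c : R) (b : 'rV[R]_n) :
  measurable_fun [set: 'rV[R]_n] (fun y : 'rV[R]_n => c *: y + b).
Proof.
apply: measurable_fun_rVP => i.
rewrite (_ : _ \o _ = (fun y => c * rV_coord i y + b ord0 i)); last first.
  by apply/funext => y; rewrite /rV_coord /= !mxE.
by apply: measurable_funD => //; apply: measurable_funM => //;
  exact: measurable_rV_coord.
Qed.

Lemma ge0_integral_lebesgue_rVS n (f : 'rV[R]_n.+1 -> \bar R) :
  measurable_fun [set: 'rV[R]_n.+1] f -> (forall y, 0 <= f y)%E ->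
  (\int[lebesgue_rV R n.+1]_y f y =
   \int[mu]_t \int[lebesgue_rV R n]_z f (cons_rV (t, z)))%E.
Proof.
move=> mf f0.
rewrite -[LHS]/(\int[pushforward (mu \x lebesgue_rV R n)%E (@cons_rV R n)]_y f y)%E.
rewrite (ge0_integral_pushforward (@measurable_cons_rV R n))//.
rewrite preimage_setT fubini_tonelli1//; last first.
  by move=> x; exact: f0.
by apply: measurableT_comp => //; exact: measurable_cons_rV.
Qed.

(** Induction on the dimension through Tonelli: the first coordinate contributes one factor [c], the
    induction hypothesis the others. *)
Lemma ge0_integral_rV_affine n (c : R) (b : 'rV[R]_n) (f : 'rV[R]_n -> \bar R) :
  0 < c -> measurable_fun [set: 'rV[R]_n] f -> (forall y, 0 <= f y)%E ->
  (\int[lebesgue_rV R n]_y f y =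
   (c ^+ n)%:E * \int[lebesgue_rV R n]_y f (c *: y + b)%R)%E.
Proof.
move=> c0; elim: n b f => [|n IH] b f mf f0.
  rewrite expr0 mul1e; apply: eq_integral => y _; congr f.
  by apply/matrixP => i [].
have mfc : measurable_fun setT (fun x : R * 'rV[R]_n => f (cons_rV x)).
  by apply: measurableT_comp => //; exact: measurable_cons_rV.
rewrite !ge0_integral_lebesgue_rVS//; last first.
  by apply: measurableT_comp => //; exact: measurable_affine_rV.
pose b' := \row_j b ord0 (lift ord0 j).
have consE t z : c *: cons_rV (t, z) + b = cons_rV (c * t + b ord0 ord0, c *: z + b').
  apply/rowP => i; rewrite !mxE; case: unliftP => [j ->|->] //=.
  by rewrite !mxE.
have mfs t : measurable_fun [set: 'rV[R]_n] (fun z => f (cons_rV (t, z))).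
  by apply: (measurableT_comp mfc); exact: pair1_measurable.
pose F t := (\int[lebesgue_rV R n]_z f (cons_rV (t, z)))%E.
have mF : measurable_fun setT F.
  exact: (@measurable_fun_fubini_tonelli_F _ _ _ _ R (lebesgue_rV R n) _ mfc).
have F0 t : (0 <= F t)%E by apply: integral_ge0.
rewrite (@ge0_integral_affine _ c (b ord0 ord0) F)//.
rewrite exprS EFinM -muleA; congr (_ * _)%E.
have mFa : measurable_fun [set: R] (fun t => F (c * t + b ord0 ord0)).
  apply: measurableT_comp => //; exact: measurable_funD.
under [X in (_ = _ * X)%E]eq_integral => t _.
  under eq_integral do rewrite consE.
  over.
rewrite -ge0_integralZl//.
- apply: eq_integral => t _; rewrite /F (IH b')//.
- have mg : measurable_fun setT (fun x : R * 'rV[R]_n => f (c *: cons_rV x + b)).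
    have mc := measurableT_comp (measurable_affine_rV c b) (@measurable_cons_rV R n).
    exact: (measurableT_comp mf mc).
  have := @measurable_fun_fubini_tonelli_F _ _ _ _ R (lebesgue_rV R n) _ mg.
  move=> /(_ (fun=> f0 _)); apply: eq_measurable_fun => t _.
  by apply: eq_integral => z _; rewrite consE.
- by move=> t _; exact: integral_ge0.
- by rewrite lee_fin exprn_ge0// ltW.
Qed.

End lebesgue_rV_affine.

(** * Borel measurability of continuous functions on R^n *)

Section continuous_rV.
Context {R : realType} {n : nat}.

(** Centre and radius are rational, so that an open set is a countable union of boxes, each
    measurable for the product sigma-algebra. *)
Let box (q : 'rV[rat]_n * rat) : set 'rV[R]_n :=
  [set x | forall i, `|x ord0 i - ratr (q.1 ord0 i)| < ratr q.2].

Let measurable_box q : measurable (box q).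
Proof.
rewrite (_ : box q = \bigcap_(i in [set: 'I_n]) (@rV_coord _ R n i @^-1`
    `](ratr (q.1 ord0 i) - ratr q.2), (ratr (q.1 ord0 i) + ratr q.2)[)).
  apply: fin_bigcap_measurable => // i _.
  by rewrite -[X in measurable X]setTI; exact: measurable_rV_coord.
apply/seteqP; split=> x /= h i; have := h i => /=; rewrite /rV_coord in_itv /= ltr_distl//.
by move=> /(_ I).
Qed.

Lemma open_measurable_rV (A : set 'rV[R]_n) : open A -> measurable A.
Proof.
move=> oA.
pose F q := if pselect (box q `<=` A) then box q else set0.
suff -> : A = \bigcup_(q in setT) F q.
  apply: countable_bigcupT_measurable; first exact: countableP.
  by move=> q; rewrite /F; case: pselect => ?; [exact: measurable_box|exact: measurable0].
apply/seteqP; split=> [x Ax|x [q _]]; last first.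
  by rewrite /F; case: pselect => // h; exact: h.
have /nbhs_ballP[e /= e0 eA] : nbhs x A by exact: open_nbhs_nbhs.
(* With radius below [e / 2], a box containing [x] stays inside the sup-norm ball of radius [e]
   around [x]. *)
have [r] := @rat_in_itvoo R 0 (e / 2) ltac:(lra).
rewrite in_itv /= => /andP[r0 re].
have {}/choice[q Hq] : forall i, exists q, `|x ord0 i - ratr q| < ratr r.
  move=> i; have [q] := @rat_in_itvoo R (x ord0 i - ratr r) (x ord0 i) ltac:(lra).
  rewrite in_itv /= => /andP[h1 h2]; exists q; rewrite ltr_distl; apply/andP; split; lra.
exists (\row_i q i, r) => //; rewrite /F; case: pselect => [_ i|[]].
  by rewrite /= mxE.
move=> y By; apply: eA; split=> // i j; rewrite /ball /= !ord1.
have := By j; have := Hq j; rewrite /= mxE !ltr_distl => /andP[? ?] /andP[? ?].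
by apply/andP; split; lra.
Qed.

Lemma continuous_measurable_rV (f : 'rV[R]_n -> R) :
  continuous f -> measurable_fun [set: 'rV[R]_n] f.
Proof.
move=> /continuousP cf; apply: (measurability _ (RGenOpens.measurableE R)).
move=> _ [_ [a [b ->] <-]]; rewrite setTI; apply: open_measurable_rV.
exact/cf/interval_open.
Qed.

End continuous_rV.

(** * The Euclidean norm and its inner product *)

Section enorm.
Context {R : realType} {n : nat}.
Implicit Types (x y z : 'rV[R]_n).

Definition dot x y : R := \sum_(i < n) x ord0 i * y ord0 i.

Lemma dotC x y : dot x y = dot y x.
Proof. by apply: eq_bigr => i _; rewrite mulrC. Qed.

Lemma dotDl x y z : dot (x + y) z = dot x z + dot y z.
Proof. by rewrite -big_split; apply: eq_bigr => i _; rewrite !mxE mulrDl. Qed.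

Lemma dotZl c x y : dot (c *: x) y = c * dot x y.
Proof. by rewrite mulr_sumr; apply: eq_bigr => i _; rewrite !mxE mulrA. Qed.

Lemma dotxx_ge0 x : 0 <= dot x x.
Proof. by apply: sumr_ge0 => i _; rewrite -expr2 sqr_ge0. Qed.

Lemma enorm_dot x : enorm x = Num.sqrt (dot x x).
Proof. by rewrite /enorm; congr Num.sqrt; apply: eq_bigr => i _; rewrite expr2. Qed.

Lemma sqr_enorm x : enorm x ^+ 2 = dot x x.
Proof. by rewrite enorm_dot sqr_sqrtr// dotxx_ge0. Qed.

Lemma enorm_ge0 x : 0 <= enorm x. Proof. exact: sqrtr_ge0. Qed.

Lemma enormZ c x : enorm (c *: x) = `|c| * enorm x.
Proof.
by rewrite !enorm_dot dotZl dotC dotZl mulrA -expr2 sqrtrM ?sqr_ge0// sqrtr_sqr.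
Qed.

Lemma enormN x : enorm (- x) = enorm x.
Proof. by rewrite -scaleN1r enormZ normrN1 mul1r. Qed.

Lemma enorm_distC x y : enorm (x - y) = enorm (y - x).
Proof. by rewrite -enormN opprB. Qed.

Lemma enorm0 : enorm (0 : 'rV[R]_n) = 0.
Proof. by rewrite -(scale0r 0) enormZ normr0 mul0r. Qed.

Lemma coord_le_enorm x i : `|x ord0 i| <= enorm x.
Proof.
rewrite -sqrtr_sqr ler_wsqrtr// (bigD1 i)//= lerDl.
by apply: sumr_ge0 => j _; rewrite sqr_ge0.
Qed.

Lemma enorm_eq0 x : (enorm x == 0) = (x == 0).
Proof.
apply/eqP/eqP => [h|->]; last exact: enorm0.
apply/rowP => i; rewrite mxE; apply/eqP; rewrite -normr_le0.
by have := coord_le_enorm x i; rewrite h.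
Qed.

Lemma enorm_gt0 x : (0 < enorm x) = (x != 0).
Proof. by rewrite lt0r enorm_ge0 andbT enorm_eq0. Qed.

(** Cauchy--Schwarz: expand the nonnegative square of [|y|^2 x - (x.y) y] and divide by [|y|^2]. *)
Lemma dot_le_enorm x y : dot x y <= enorm x * enorm y.
Proof.
have [->|y0] := eqVneq y 0.
  by rewrite enorm0 mulr0 /dot big1// => i _; rewrite mxE mulr0.
have ny : 0 < enorm y by rewrite enorm_gt0.
have := dotxx_ge0 (enorm y ^+ 2 *: x - dot x y *: y).
rewrite -scaleN1r scalerA mulN1r.
rewrite !(dotDl, dotZl) ![dot _ (_ + _)]dotC !(dotDl, dotZl) (dotC y x) -!sqr_enorm.
move=> h.
have {h} : 0 <= enorm y ^+ 2 * ((enorm x * enorm y) ^+ 2 - dot x y ^+ 2).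
  by move: h; congr (_ <= _); ring.
rewrite pmulr_rge0 ?exprn_gt0// subr_ge0 => h.
apply: (le_trans (ler_norm _)).
by rewrite -(@ler_pXn2r _ 2)// ?nnegrE ?mulr_ge0 ?enorm_ge0// real_normK// num_real.
Qed.

Lemma enormB_sqr x y :
  enorm (x - y) ^+ 2 = enorm x ^+ 2 - 2 * dot x y + enorm y ^+ 2.
Proof.
rewrite !sqr_enorm -scaleN1r.
by rewrite !(dotDl, dotZl) ![dot _ (_ + _)]dotC !(dotDl, dotZl) (dotC y x); ring.
Qed.

Lemma ler_enormD x y : enorm (x + y) <= enorm x + enorm y.
Proof.
rewrite -(@ler_pXn2r _ 2)// ?nnegrE ?addr_ge0 ?enorm_ge0//.
rewrite -[y in x + y]opprK enormB_sqr enormN.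
have -> : dot x (- y) = - dot x y by rewrite dotC -scaleN1r dotZl mulN1r dotC.
have := dot_le_enorm x y; rewrite sqrrD; lra.
Qed.

Lemma ler_enormB x y : enorm (x - y) <= enorm x + enorm y.
Proof. by rewrite -(enormN y) ler_enormD. Qed.

Lemma lerB_enorm x y : enorm x - enorm y <= enorm (x - y).
Proof. by rewrite lerBlDr -{1}(subrK y x) ler_enormD. Qed.

Lemma continuous_enorm : continuous (@enorm R n).
Proof.
have cs : continuous (fun x : 'rV[R]_n => \sum_(i < n) x ord0 i ^+ 2).
  apply: continuous_big => [|i _ x]; first exact: add_continuous.
  exact: (continuous_comp (@coord_continuous _ _ _ _ _ _) (@exprn_continuous R 2 _)).
by move=> x; exact: (continuous_comp (cs x) (@sqrt_continuous R _)).
Qed.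

(** Boundedness is meant for the sup norm, which the Euclidean norm dominates. *)
Lemma enorm_closed_ball_compact r : compact [set x : 'rV[R]_n | enorm x <= r].
Proof.
apply: bounded_closed_compact.
  exists r; split; first exact: num_real.
  move=> M rM x /= xr; apply: (le_trans _ (ltW rM)); apply: (le_trans _ xr).
  rewrite /Num.norm /= mx_normrE; apply/bigmax_leP; split; first exact: enorm_ge0.
  by move=> [i j] _ /=; rewrite !ord1; exact: coord_le_enorm.
apply: (@closed_comp _ _ (@enorm R n) [set t | t <= r]); last exact: closed_le.
by move=> x _; exact: continuous_enorm.
Qed.

Lemma measurable_enorm : measurable_fun [set: 'rV[R]_n] (@enorm R n).
Proof. exact: continuous_measurable_rV continuous_enorm. Qed.

Lemma measurable_enormB x : measurable_fun [set: 'rV[R]_n] (fun y => enorm (x - y)).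
Proof.
have h : (fun y => enorm (x - y)) = (fun y => enorm ((1 : R) *: y + (- x))).
  by apply/funext => y; rewrite scale1r enorm_distC.
rewrite h; apply: (measurableT_comp measurable_enorm).
exact: measurable_affine_rV.
Qed.

End enorm.

(** * Volume of balls and annuli *)

Section volume.
Context {R : realType}.

Lemma lebesgue_rV_affine n (c : R) (b : 'rV[R]_n) (A : set 'rV[R]_n) :
  0 < c -> measurable A ->
  lebesgue_rV R n A =
  ((c ^+ n)%:E * lebesgue_rV R n ((fun y => c *: y + b)%R @^-1` A))%E.
Proof.
move=> c0 mA.
have mA' : measurable ((fun y : 'rV[R]_n => c *: y + b) @^-1` A).
  by rewrite -[X in measurable X]setTI; exact: measurable_affine_rV.
have -> : lebesgue_rV R n A = (\int[lebesgue_rV R n]_y (\1_A y)%:E)%E.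
  by rewrite integral_indic// setIT.
rewrite (ge0_integral_rV_affine b c0)//; last first.
  by apply/measurable_EFinP; exact: measurable_indic.
congr (_ * _)%E.
rewrite -[in RHS](setIT (_ @^-1` _)) -integral_indic//.
Qed.

Lemma measurable_cube_rV n :
  measurable [set x : 'rV[R]_n | forall i, -1 < x ord0 i < 1].
Proof.
rewrite (_ : [set _ | _] = \bigcap_(i in [set: 'I_n]) (@rV_coord _ R n i @^-1`
    `]-1, 1[)).
  apply: fin_bigcap_measurable => // i _.
  by rewrite -[X in measurable X]setTI; exact: measurable_rV_coord.
apply/seteqP; split=> x /= h i; have := h i => /=; rewrite /rV_coord /= in_itv //=.
by move=> /(_ I).
Qed.

(** Comparing this cube with balls from both sides shows that the volume of the unit ball is finite
    and positive. *)
Lemma lebesgue_rV_cube n :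
  lebesgue_rV R n [set x | forall i, -1 < x ord0 i < 1] = (2 ^+ n)%:E.
Proof.
elim: n => [|n IH].
  rewrite expr0 /lebesgue_rV /= diracE mem_set//= => -[]//.
rewrite -[LHS]/((lebesgue_measure \x lebesgue_rV R n)%E
  (@cons_rV R n @^-1` [set x | forall i, -1 < x ord0 i < 1])).
rewrite (_ : _ @^-1` _ = `]-1, 1[%classic `*`
    [set x : 'rV[R]_n | forall i, -1 < x ord0 i < 1]); last first.
  apply/seteqP; split=> [[t z] /= h|[t z] /= [h1 h2] i].
    split; first by have := h ord0; rewrite cons_rV0 in_itv.
    by move=> i; have := h (lift ord0 i); rewrite cons_rVS.
  case: (unliftP ord0 i) => [j ->|->]; first by rewrite cons_rVS.
  by rewrite cons_rV0; move: h1; rewrite in_itv.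
rewrite product_measure1E//; last exact: measurable_cube_rV.
rewrite [X in (_ * X)%E]IH.
have hI : lebesgue_measure (`](-1 : R), 1[%classic : set R) = (2 : R)%:E.
  rewrite lebesgue_measure_itv /= lte_fin ifT; last by lra.
  by rewrite -EFinD; congr (_%:E); lra.
by transitivity ((2 : R)%:E * (2 ^+ n)%:E)%E; [congr (_ * _)%E|rewrite -EFinM -exprS].
Qed.

Context {n : nat}.
Hypothesis n0 : (0 < n)%N.
Local Notation mu := (lebesgue_rV R n).
Local Notation B1 := [set y : 'rV[R]_n | enorm y < 1].

Lemma measurable_ball_rV (x : 'rV[R]_n) r : measurable [set y | enorm (x - y) < r].
Proof.
rewrite (_ : [set _ | _] = (fun y => enorm (x - y)) @^-1` `]-oo, r[); last first.
  by apply/seteqP; split=> y /=; rewrite in_itv.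
by rewrite -[X in measurable X]setTI; exact: measurable_enormB.
Qed.

Lemma measurable_ball0_rV r : measurable [set y : 'rV[R]_n | enorm y < r].
Proof.
rewrite (_ : [set _ | _] = [set y | enorm (0 - y) < r]); last first.
  by apply/seteqP; split=> y /=; rewrite sub0r enormN.
exact: measurable_ball_rV.
Qed.

Let volume_scale (x : 'rV[R]_n) r : 0 < r ->
  mu [set y | enorm (x - y) < r] = ((r ^+ n)%:E * mu B1)%E.
Proof.
move=> r0; rewrite (@lebesgue_rV_affine _ r x)//; last exact: measurable_ball_rV.
congr (_ * mu _)%E; apply/seteqP; split=> y /=;
  rewrite opprD addrC subrK enormN enormZ gtr0_norm//; nra.
Qed.

Definition unit_volume := fine (mu B1).

Let unit_volume_fin : (mu B1 < +oo)%E.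
Proof.
apply: (@le_lt_trans _ _ (mu [set x | forall i, -1 < x ord0 i < 1])); last first.
  by rewrite [X in (X < _)%E]lebesgue_rV_cube ltry.
apply: le_measure; rewrite ?inE; first exact: measurable_ball0_rV.
  exact: measurable_cube_rV.
move=> x /= xr i; rewrite -ltr_norml; exact: (le_lt_trans (coord_le_enorm x i)).
Qed.

Lemma unit_volume_gt0 : 0 < unit_volume.
Proof.
rewrite /unit_volume fine_gt0// unit_volume_fin andbT lt0e measure_ge0 andbT.
apply/eqP => h0.
(* On the cube [|x| <= sqrt n < n + 1], so if the unit ball were null, its dilate by [n + 1], and
   hence the cube, would be null too. *)
have n1 : 0 < n.+1%:R :> R by [].
have := volume_scale 0 n1; rewrite h0 mule0.
apply/eqP; rewrite gt_eqF//.
apply: (@lt_le_trans _ _ (mu [set x | forall i, -1 < x ord0 i < 1])).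
  by rewrite [X in (_ < X)%E]lebesgue_rV_cube lte_fin exprn_gt0.
apply: le_measure; rewrite ?inE; [exact: measurable_cube_rV|exact: measurable_ball_rV|].
move=> x /= xi; rewrite sub0r enormN.
have : enorm x ^+ 2 <= n%:R.
  rewrite /enorm sqr_sqrtr; last by apply: sumr_ge0 => i _; rewrite sqr_ge0.
  rewrite -[leRHS]mulr1 -[X in X%:R * _]card_ord -sumr_const mulr_suml.
  by apply: ler_sum => i _; rewrite mul1r; have /andP[] := xi i => ? ?; nra.
have : n%:R < n.+1%:R ^+ 2 :> R.
  by rewrite -natrX ltr_nat -mulnn leq_pmulr.
move=> h1 h2; rewrite ltNge; apply/negP => h3.
have := enorm_ge0 x; nra.
Qed.

Lemma volume_ball (x : 'rV[R]_n) r : 0 < r ->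
  mu [set y | enorm (x - y) < r] = (r ^+ n * unit_volume)%:E.
Proof.
move=> r0; rewrite volume_scale// EFinM fineK// ge0_fin_numE//.
Qed.

Lemma volume_ball0 r : 0 < r ->
  mu [set y | enorm y < r] = (r ^+ n * unit_volume)%:E.
Proof.
move=> r0; rewrite -(@volume_ball 0)//; congr (mu _).
by apply/seteqP; split=> y /=; rewrite sub0r enormN.
Qed.

Lemma measurable_annulus r s : measurable [set y : 'rV[R]_n | r <= enorm y < s].
Proof.
rewrite (_ : [set _ | _] = [set y | enorm y < s] `\` [set y | enorm y < r]).
  by apply: measurableD; exact: measurable_ball0_rV.
by apply/seteqP; split=> y /=; [move=> /andP[h1 h2]|move=> [h1 /negP h2]];
  rewrite -?leNgt; [split=> //; apply/negP; rewrite -leNgt|apply/andP; split=> //; rewrite leNgt].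
Qed.

Lemma volume_annulus r s : 0 < r -> r <= s ->
  mu [set y | r <= enorm y < s] = ((s ^+ n - r ^+ n) * unit_volume)%:E.
Proof.
move=> r0 rs.
rewrite (_ : [set _ | _] = [set y | enorm y < s] `\` [set y | enorm y < r]); last first.
  by apply/seteqP; split=> y /=; [move=> /andP[h1 h2]|move=> [h1 /negP h2]];
  rewrite -?leNgt; [split=> //; apply/negP; rewrite -leNgt|apply/andP; split=> //; rewrite leNgt].
have s0 := lt_le_trans r0 rs.
rewrite measureD; [|exact: measurable_ball0_rV..|]; last first.
  by rewrite [X in (X < _)%E](volume_ball0 s0) ltry.
rewrite (_ : _ `&` _ = [set y | enorm y < r]).
  transitivity (((s ^+ n * unit_volume)%:E - (r ^+ n * unit_volume)%:E)%E).
    by congr (_ - _)%E; exact: volume_ball0.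
  by rewrite -EFinB mulrBl.
by apply/seteqP; split=> y /=; [case|move=> h; split=> //; exact: lt_le_trans rs].
Qed.

(** A point lies in balls of arbitrarily small volume. Hence integrands may be compared away from
    points where an inverse of 0 takes its default value. *)
Lemma negligible_set1_rV (x : 'rV[R]_n) : mu.-negligible [set x].
Proof.
pose F (k : nat) := [set y : 'rV[R]_n | enorm (x - y) < k.+1%:R^-1].
exists (\bigcap_k F k); split.
- by apply: bigcapT_measurable => k; exact: measurable_ball_rV.
- apply/eqP; rewrite eq_le measure_ge0 andbT.
  apply/lee_addgt0Pr => e e0; rewrite add0e.
  have kap := unit_volume_gt0.
  pose k := Num.truncn (unit_volume / e).
  have hk : unit_volume / e < k.+1%:R by exact: truncnS_gt.
  apply: (@le_trans _ _ (mu (F k))).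
    apply: le_measure; rewrite ?inE; last by move=> y /(_ k); exact.
      by apply: bigcapT_measurable => j; exact: measurable_ball_rV.
    exact: measurable_ball_rV.
  rewrite volume_ball ?invr_gt0// lee_fin.
  apply: (@le_trans _ _ (k.+1%:R^-1 * unit_volume)).
    rewrite ler_pM2r// -(prednK n0) exprS ler_piMr// ?invr_ge0//.
    by rewrite exprn_ile1 ?invr_ge0// invf_le1// ler1n.
  rewrite mulrC ler_pdivrMr//.
  by move: hk; rewrite ltr_pdivrMr// mulrC => /ltW.
- move=> y /= -> k _; rewrite /F /= subrr enorm0 invr_gt0//.
Qed.

End volume.

(** * Inversion in a sphere *)

Section inversion.
Context {R : realType} {n : nat}.
Local Notation mu := (lebesgue_rV R n).
Implicit Types (f g G : 'rV[R]_n -> R) (l : R).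

Lemma measurable_fun_invr d (T : measurableType d) (f : T -> R) :
  measurable_fun setT f -> (forall x, 0 <= f x) ->
  measurable_fun setT (fun x => (f x)^-1).
Proof.
move=> mf f0; have -> : (fun x => (f x)^-1) = (fun x => f x `^ (-1)).
  by apply/funext => x; rewrite powR_inv1.
exact: (measurableT_comp (@measurable_powR R (-1)) mf).
Qed.

Lemma measurable_fun_scale_rV d (T : measurableType d) (c : T -> R) (h : T -> 'rV[R]_n) :
  measurable_fun setT c -> measurable_fun setT h ->
  measurable_fun setT (fun x => c x *: h x).
Proof.
move=> mc mh; apply: measurable_fun_rVP => i.
rewrite (_ : _ \o _ = (fun x => c x * (rV_coord i \o h) x)); last first.
  by apply/funext => x; rewrite /rV_coord /= mxE.
apply: measurable_funM => //; apply: measurableT_comp => //.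
exact: measurable_rV_coord.
Qed.

(** The reflection in the sphere of radius [l]. The default inverse of 0 makes it fix the origin,
    which is therefore excluded from most identities. *)
Definition inversion l (y : 'rV[R]_n) : 'rV[R]_n := (l ^+ 2 / enorm y ^+ 2) *: y.

Lemma measurable_inversion l : measurable_fun [set: 'rV[R]_n] (inversion l).
Proof.
apply: (@measurable_fun_scale_rV _ _ (fun y => l ^+ 2 / enorm y ^+ 2) id) => //.
apply: measurable_funM => //; apply: measurable_fun_invr.
  by apply: measurable_funX; exact: measurable_enorm.
by move=> x; rewrite exprn_ge0// enorm_ge0.
Qed.

Lemma enorm_inversion l y : enorm (inversion l y) = l ^+ 2 / enorm y.
Proof.
rewrite enormZ ger0_norm; last by rewrite divr_ge0// ?sqr_ge0.
have [->|y0] := eqVneq (enorm y) 0; first by rewrite mulr0 invr0 mulr0.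
by field.
Qed.

(** The exceptional points are the origin, where the inversion degenerates, and [x], meant to be the
    pole of the kernel. *)
Lemma ge0_le_integral_rV_but f g (x : 'rV[R]_n) : (0 < n)%N ->
  measurable_fun setT f -> measurable_fun setT g ->
  (forall y, 0 <= f y) -> (forall y, 0 <= g y) ->
  (forall y, y != 0 -> y != x -> f y <= g y) ->
  (\int[mu]_y (f y)%:E <= \int[mu]_y (g y)%:E)%E.
Proof.
move=> n0 mf mg f0 g0 fg; apply: ae_ge0_le_integral => //.
- by move=> y _; rewrite lee_fin.
- exact/measurable_EFinP.
- by move=> y _; rewrite lee_fin.
- exact/measurable_EFinP.
apply: (@negligibleS _ _ _ _ ([set 0] `|` [set x])); last first.
  by apply: negligibleU; exact: negligible_set1_rV.
move=> y /= h; apply: contrapT => hy; apply: h => _; rewrite lee_fin; apply: fg.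
  by apply/eqP => y0; apply: hy; left.
by apply/eqP => y0; apply: hy; right.
Qed.

Lemma ge0_eq_integral_rV_but0 f g : (0 < n)%N ->
  measurable_fun setT f -> measurable_fun setT g ->
  (forall y, 0 <= f y) -> (forall y, 0 <= g y) ->
  (forall y, y != 0 -> f y = g y) ->
  (\int[mu]_y (f y)%:E = \int[mu]_y (g y)%:E)%E.
Proof.
move=> n0 mf mg f0 g0 fg; apply/eqP; rewrite eq_le.
by apply/andP; split; apply: (@ge0_le_integral_rV_but _ _ 0) => // y y0 _; rewrite fg.
Qed.

Let tonelli (f : measurableTypeR R * 'rV[R]_n -> R) :
  measurable_fun setT f -> (forall x, 0 <= f x) ->
  (\int[@lebesgue_measure R]_s \int[mu]_y (f (s, y))%:E =
   \int[mu]_y \int[@lebesgue_measure R]_s (f (s, y))%:E)%E.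
Proof.
move=> mf f0.
apply: (@fubini_tonelli _ _ _ _ R (@lebesgue_measure R) mu (EFin \o f)) => //.
exact/measurable_EFinP.
Qed.

Let w (y : 'rV[R]_n) := (enorm y ^+ n)^-1.
Let w_ge0 y : 0 <= w y. Proof. by rewrite invr_ge0 exprn_ge0// enorm_ge0. Qed.
Let mw : measurable_fun setT w.
Proof.
apply: measurable_fun_invr => [|x]; last by rewrite exprn_ge0// enorm_ge0.
by apply: measurable_funX; exact: measurable_enorm.
Qed.

(** A function of integral 1 on the group of dilations, written additively through the logarithm. *)
Let chi (t : R) : R := (0 <= t < 1)%R%:R.
Let chi_ge0 t : 0 <= chi t. Proof. by rewrite /chi ler0n. Qed.
Let mchi d (T : measurableType d) (h : T -> R) :
  measurable_fun setT h -> measurable_fun setT (chi \o h).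
Proof.
move=> mh; rewrite (_ : chi = \1_(`[0, 1[%classic)).
  by apply: measurableT_comp => //; exact: measurable_indic.
by apply/funext => t; rewrite /chi indicE mem_setE in_itv.
Qed.

Let mln : measurable_fun setT (fun y : 'rV[R]_n => ln (enorm y)).
Proof.
by apply: (measurableT_comp (@measurable_ln R)); exact: measurable_enorm.
Qed.

Let integral_chi (c t : R) : 0 <= c ->
  (\int[@lebesgue_measure R]_s (c * chi (t + s))%:E = c%:E)%E.
Proof.
move=> c0; under eq_integral do rewrite EFinM.
rewrite ge0_integralZl//; last 2 first.
- apply/measurable_EFinP; apply: mchi; exact: measurable_funD.
- by move=> s _; rewrite lee_fin.
have hI : lebesgue_measure (`[(- t), (1 - t)[%classic : set R) = (1 : R)%:E.
  rewrite lebesgue_measure_itv /= lte_fin ifT; last by lra.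
  by rewrite -EFinD; congr (_%:E); lra.
rewrite -[RHS]mule1; congr (_ * _)%E.
transitivity (\int[@lebesgue_measure R]_s (\1_(`[(- t), (1 - t)[%classic) s)%:E)%E.
  apply: eq_integral => s _; congr (_%:E); rewrite /chi indicE mem_setE in_itv /=.
  by congr (nat_of_bool (_ && _))%:R; apply/idP/idP; lra.
by rewrite integral_indic// setIT; exact: hI.
Qed.

Hypothesis n0 : (0 < n)%N.

Let w0 : w 0 = 0.
Proof. by rewrite /w enorm0 expr0n eqn0Ngt n0 invr0. Qed.

(* The measure dy / |y|^n is invariant under dilations: averaging over the
   dilation group reduces integrals against it to the shell 1 <= |y| < e. *)
Let integral_shell g : measurable_fun setT g -> (forall y, 0 <= g y) ->
  (\int[mu]_y (g y * w y)%:E =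
   \int[mu]_y \int[@lebesgue_measure R]_s
     (g (expR (- s) *: y) * (w y * chi (ln (enorm y))))%:E)%E.
Proof.
move=> mg g0.
(* [F] inserts the factor 1 as the integral of [chi (ln |y| + s)] over [s]. [H] is what [F] becomes
   under [y |-> exp(-s) y], whose Jacobian cancels the scaling of [w]. *)
pose F (x : measurableTypeR R * 'rV[R]_n) := g x.2 * w x.2 * chi (ln (enorm x.2) + x.1).
have mF : measurable_fun setT F.
  apply: measurable_funM; first by apply: measurable_funM; exact: measurableT_comp.
  apply: mchi; apply: measurable_funD => //.
  by apply: (measurableT_comp mln).
pose H (x : measurableTypeR R * 'rV[R]_n) :=
  g (expR (- x.1) *: x.2) * (w x.2 * chi (ln (enorm x.2))).
have mH : measurable_fun setT H.
  apply: measurable_funM.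
    apply: measurableT_comp => //; apply: measurable_fun_scale_rV => //.
    apply: measurableT_comp; first exact: measurable_expR.
    by apply: measurableT_comp.
  apply: measurable_funM; first exact: measurableT_comp.
  apply: mchi; exact: (measurableT_comp mln).
transitivity (\int[mu]_y \int[@lebesgue_measure R]_s (F (s, y))%:E)%E.
  by apply: eq_integral => y _; rewrite /F /= integral_chi// mulr_ge0.
rewrite -[RHS]/(\int[mu]_y \int[@lebesgue_measure R]_s (H (s, y))%:E)%E.
rewrite -!tonelli//; last 2 first.
- by move=> x; rewrite /H !mulr_ge0.
- by move=> x; rewrite /F !mulr_ge0.
apply: eq_integral => s _.
have es := expR_gt0 (- s).
have mFs : measurable_fun setT (fun y => F (s, y)).
  apply: (measurableT_comp mF); exact: pair1_measurable.
have mHs : measurable_fun setT (fun y => H (s, y)).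
  apply: (measurableT_comp mH); exact: pair1_measurable.
rewrite (ge0_integral_rV_affine 0 es)//; last 2 first.
- exact/measurable_EFinP.
- by move=> y; rewrite lee_fin !mulr_ge0.
have mFa : measurable_fun setT (fun y : 'rV[R]_n => F (s, expR (- s) *: y + 0)).
  apply: (measurableT_comp mFs); exact: measurable_affine_rV.
rewrite -ge0_integralZl//; last 2 first.
- exact/measurable_EFinP.
- by move=> y _; rewrite lee_fin !mulr_ge0.
under eq_integral do rewrite -EFinM.
apply: ge0_eq_integral_rV_but0 => //.
- exact: measurable_funM.
- by move=> y; rewrite !mulr_ge0// exprn_ge0// ltW.
- by move=> y; rewrite !mulr_ge0.
move=> y y0; rewrite /F /H /= addr0.
have ny : 0 < enorm y by rewrite enorm_gt0.
rewrite /w enormZ gtr0_norm// lnM ?posrE// expRK exprMn.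
rewrite (_ : - s + _ + s = ln (enorm y)); last by lra.
by field; rewrite !expf_neq0 ?gt_eqF.
Qed.

(** On the ray of the points [exp(-s) y] the inversion acts as [s |-> -s - 2 ln(l / |y|)], a
    reflection composed with a translation. Both preserve Lebesgue measure on the line. *)
Let integral_inversion_w l g : 0 < l ->
  measurable_fun setT g -> (forall y, 0 <= g y) ->
  (\int[mu]_y (g (inversion l y) * w y)%:E = \int[mu]_y (g y * w y)%:E)%E.
Proof.
move=> l0 mg g0; rewrite (@integral_shell (g \o inversion l)); last 2 first.
- exact: (measurableT_comp mg (measurable_inversion l)).
- by move=> y; exact: g0.
rewrite integral_shell//; apply: eq_integral => y _.
have [->|y0] := eqVneq y 0.
  by apply: eq_integral => s _; rewrite w0 !mul0r !mulr0.
have ny : 0 < enorm y by rewrite enorm_gt0.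
set c := w y * _.
pose H s := (g (expR (- s) *: y) * c)%:E.
have c0 : 0 <= c by rewrite mulr_ge0.
have mH : measurable_fun [set: R] H.
  apply/measurable_EFinP; apply: measurable_funM => //.
  apply: measurableT_comp => //; apply: measurable_fun_scale_rV => //.
  by apply: measurableT_comp => //; exact: measurable_expR.
have H0 s : (0 <= H s)%E by rewrite lee_fin mulr_ge0.
rewrite -[RHS]/(\int[@lebesgue_measure R]_s H s)%E [RHS]ge0_integral_opp//.
have mHN : measurable_fun [set: R] (fun s => H (- s)).
  by apply: measurableT_comp => //; exact: oppr_measurable.
rewrite (@ge0_integral_affine _ 1 (2 * ln (l / enorm y)) (fun s => H (- s)))// mul1e.
apply: eq_integral => s _; rewrite /H; congr (g _ * _)%:E.
rewrite opprK mul1r /= /inversion enormZ gtr0_norm ?expR_gt0// scalerA.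
congr (_ *: _).
have ln0 : 0 < l / enorm y by rewrite divr_gt0.
rewrite expRD expRM_natl lnK ?posrE// expRN.
have := expR_gt0 s => es; field.
by rewrite !gt_eqF.
Qed.

(** Write [G y = g y / |y|^n] and use the invariance of [dy / |y|^n]. The Jacobian appears as
    [(l^2 / |y|)^n / |y|^n]. *)
Lemma ge0_integral_inversion l G : 0 < l ->
  measurable_fun setT G -> (forall y, 0 <= G y) ->
  (\int[mu]_y (G y)%:E =
   \int[mu]_y (G (inversion l y) * (l / enorm y) ^+ (2 * n))%:E)%E.
Proof.
move=> l0 mG G0.
have mn : measurable_fun setT (fun y : 'rV[R]_n => enorm y ^+ n).
  by apply: measurable_funX; exact: measurable_enorm.
pose g y := G y * enorm y ^+ n.
have mg : measurable_fun setT g by exact: measurable_funM.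
have g0 y : 0 <= g y by rewrite mulr_ge0// exprn_ge0// enorm_ge0.
transitivity (\int[mu]_y (g y * w y)%:E)%E.
  apply: ge0_eq_integral_rV_but0 => //.
  - exact: measurable_funM.
  - by move=> y; rewrite mulr_ge0.
  move=> y y0; rewrite /g /w mulfK// expf_neq0//.
  by rewrite enorm_eq0.
rewrite -(integral_inversion_w l0 mg g0); apply: eq_integral => y _.
congr (_%:E); rewrite /g /w -mulrA; congr (_ * _).
rewrite enorm_inversion.
have [->|y0] := eqVneq (enorm y) 0.
  by rewrite invr0 !mulr0 expr0n eqn0Ngt n0 mul0r expr0n muln_eq0 /= eqn0Ngt n0.
by rewrite exprM -exprVn -exprMn; congr (_ ^+ _); field.
Qed.

End inversion.

(** * Distances under inversion *)

Section inversion_geometry.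
Context {R : realType} {n : nat}.
Implicit Types (x y : 'rV[R]_n) (l : R).

Lemma dot_inversionl l x y : dot (inversion l x) y = l ^+ 2 / enorm x ^+ 2 * dot x y.
Proof. by rewrite dotZl. Qed.

(** Expand both squares. The correction term is nonnegative when both points lie in the ball and
    zero when [y] is on the sphere, and the right-hand side is symmetric in [x] and [y]; all
    comparisons of the two kernels rest on this. *)
Lemma inversion_distl l x y : 0 < l -> x != 0 ->
  (enorm x / l * enorm (inversion l x - y)) ^+ 2 =
  enorm (x - y) ^+ 2 + (l ^+ 2 - enorm x ^+ 2) * (l ^+ 2 - enorm y ^+ 2) / l ^+ 2.
Proof.
rewrite -enorm_gt0 => l0 x0.
rewrite exprMn !enormB_sqr enorm_inversion dot_inversionl.
by field; rewrite !gt_eqF.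
Qed.

Lemma inversion_dist l x y : 0 < l -> x != 0 -> y != 0 ->
  enorm (inversion l x - inversion l y) = l ^+ 2 * enorm (x - y) / (enorm x * enorm y).
Proof.
rewrite -!enorm_gt0 => l0 x0 y0.
apply/eqP; rewrite -(@eqrXn2 _ 2)//; last 2 first.
- exact: enorm_ge0.
- by rewrite divr_ge0// mulr_ge0// ?enorm_ge0// exprn_ge0// ltW.
rewrite expr_div_n !exprMn !enormB_sqr !enorm_inversion dot_inversionl dotC dot_inversionl.
by rewrite (dotC y x); apply/eqP; field; rewrite !gt_eqF.
Qed.

Lemma inversion_dist_sym l x y : 0 < l -> x != 0 -> y != 0 ->
  enorm x / l * enorm (inversion l x - y) = enorm y / l * enorm (x - inversion l y).
Proof.
move=> l0 x0 y0; apply/eqP; rewrite -(@eqrXn2 _ 2)//; last 2 first.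
- by rewrite mulr_ge0// ?enorm_ge0// divr_ge0// ?enorm_ge0// ltW.
- by rewrite mulr_ge0// ?enorm_ge0// divr_ge0// ?enorm_ge0// ltW.
rewrite (enorm_distC x (inversion l y)) !inversion_distl// (enorm_distC y x).
by apply/eqP; ring.
Qed.

Lemma inversion_dist_le l x y : 0 < l -> x != 0 -> enorm x < l -> enorm y <= l ->
  enorm (x - y) <= enorm x / l * enorm (inversion l x - y).
Proof.
move=> l0 x0 xl yl.
rewrite -(@ler_pXn2r _ 2)// ?nnegrE ?enorm_ge0//; last first.
  by rewrite mulr_ge0// ?enorm_ge0// divr_ge0// ?enorm_ge0// ltW.
rewrite inversion_distl// lerDl divr_ge0// ?sqr_ge0//.
by rewrite mulr_ge0// subr_ge0 ler_pXn2r// ?nnegrE ?enorm_ge0// ltW.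
Qed.

Lemma inversion_dist_sphere l x y : 0 < l -> x != 0 -> enorm y = l ->
  enorm (x - y) = enorm x / l * enorm (inversion l x - y).
Proof.
move=> l0 x0 yl; apply/eqP; rewrite -(@eqrXn2 _ 2)// ?enorm_ge0//; last first.
  by rewrite mulr_ge0// ?enorm_ge0// divr_ge0// ?enorm_ge0// ltW.
by rewrite inversion_distl// yl subrr mulr0 mul0r addr0.
Qed.

Lemma inversion_scale l l' x : 0 < l -> 0 < l' ->
  inversion l x = inversion l' ((l' / l) ^+ 2 *: x).
Proof.
move=> l0 l'0; rewrite /inversion scalerA; congr (_ *: _).
rewrite enormZ ger0_norm ?sqr_ge0//.
have [->|x0] := eqVneq (enorm x) 0; first by rewrite !mulr0 expr0n /= invr0 !mulr0 mul0r.
by field; rewrite x0 !gt_eqF.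
Qed.

End inversion_geometry.

(** * Estimates for real powers *)

Section powR_estimates.
Context {R : realType}.

(** The power is monotone in its base, in a direction that depends on the sign of [a]. The sum of
    the two end values covers both signs. *)
Lemma powR_le_ends (a r s t : R) : 0 < r -> r <= t <= s ->
  t `^ a <= r `^ a + s `^ a.
Proof.
move=> r0 /andP[rt ts].
have t0 := lt_le_trans r0 rt; have s0 := lt_le_trans t0 ts.
have [a0|a0] := leP 0 a.
  apply: (@le_trans _ _ (s `^ a)); last by rewrite lerDr powR_ge0.
  by apply: ge0_ler_powR => //; rewrite nnegrE ltW.
apply: (@le_trans _ _ (r `^ a)); last by rewrite lerDl powR_ge0.
rewrite -[a]opprK powRN [leRHS]powRN lef_pV2 ?posrE ?powR_gt0//.
by apply: ge0_ler_powR; rewrite ?nnegrE ?oppr_ge0 ?(ltW a0) ?(ltW r0) ?(ltW t0).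
Qed.

Lemma powR_ge_ends (a r s t : R) : 0 < r -> r <= t <= s ->
  (r `^ (- a) + s `^ (- a))^-1 <= t `^ a.
Proof.
move=> r0 /andP[rt ts].
have t0 := lt_le_trans r0 rt; have s0 := lt_le_trans t0 ts.
rewrite -[leRHS]invrK -powRN lef_pV2 ?posrE ?addr_gt0 ?powR_gt0//.
by apply: powR_le_ends => //; rewrite rt ts.
Qed.

(* Bernoulli's inequality for integer exponents [N >= p] replaces the mean value theorem. *)
Lemma powR_lipschitz (p M : R) : 1 <= p -> 0 <= M -> exists2 L, 0 <= L &
  forall v w, 0 <= v -> v <= w -> w <= M -> w `^ p - v `^ p <= L * (w - v).
Proof.
move=> p1 M0; have p0 : 0 <= p by rewrite (le_trans _ p1).
pose N := (Num.truncn p).+1.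
have pN : p <= N%:R by rewrite ltW// truncnS_gt.
exists (N%:R * M `^ (p - 1)) => [|v w v0 vw wM]; first by rewrite mulr_ge0// powR_ge0.
have [w0|w0] := leP w 0.
  have -> : v = w by lra.
  by rewrite !subrr mulr0.
(* By homogeneity only [1 - t^p] has to be bounded, and [1 - t^p <= 1 - t^N <= N (1 - t)] for [t] in
   [0, 1]. *)
pose t := v / w.
have t0 : 0 <= t by rewrite divr_ge0// ltW.
have t1 : t <= 1 by rewrite ler_pdivrMr// mul1r.
have bern : forall j, 1 - t ^+ j <= j%:R * (1 - t).
  elim=> [|j IH]; first by rewrite expr0 subrr mul0r.
  have tj : t ^+ j <= 1 by rewrite exprn_ile1.
  by rewrite exprS -natr1; nra.
have -> : v `^ p = w `^ p * t `^ p by rewrite -powRM ?(ltW w0)// /t mulrC divfK// gt_eqF.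
have -> : v = w * t by rewrite /t mulrC divfK// gt_eqF.
have tp : t ^+ N <= t `^ p.
  have [->|t0'] := eqVneq t 0; first by rewrite expr0n powR_ge0.
  have t0'' : 0 < t by rewrite lt0r t0'.
  rewrite -powR_mulrn// /powR (negbTE t0') ler_expR.
  by apply: ler_wnM2r => //; exact: ln_le0.
have -> : w `^ p = w `^ (p - 1) * w.
  rewrite -[X in _ * X]powRr1 ?(ltW w0)// -powRD ?subrK//.
  by apply/implyP => _; rewrite gt_eqF.
have wM' : w `^ (p - 1) <= M `^ (p - 1).
  by apply: ge0_ler_powR; rewrite ?nnegrE ?subr_ge0 ?(ltW w0).
have e1 := bern N; have q0 : 0 <= w `^ (p - 1) by exact: powR_ge0.
apply: (@le_trans _ _ (w `^ (p - 1) * w * (N%:R * (1 - t)))).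
  rewrite -[X in X - _]mulr1 -mulrBr ler_wpM2l ?mulr_ge0 ?(ltW w0)//.
  lra.
rewrite [leRHS](_ : _ = M `^ (p - 1) * (w * (N%:R * (1 - t)))); last by ring.
rewrite -mulrA; apply: ler_wpM2r wM'.
by rewrite !mulr_ge0 ?(ltW w0)// subr_ge0.
Qed.

Lemma powR_unbounded (b K : R) : 0 < b -> exists2 r, 1 <= r & K < r `^ b.
Proof.
move=> b0; have K0 : 1 <= `|K| + 1 by rewrite lerDr.
have K00 : 0 < `|K| + 1 by exact: lt_le_trans K0.
exists ((`|K| + 1) `^ b^-1).
  by rewrite -[leLHS](powRr0 (`|K| + 1)) ler_powR// invr_ge0 ltW.
rewrite -powRrM mulVf ?gt_eqF// powRr1 ?(ltW K00)//.
by rewrite (le_lt_trans (ler_norm K))// ltrDl.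
Qed.

End powR_estimates.

(** * Integrals of nonnegative real functions *)

Section real_integrals.
Context {R : realType} {n : nat}.
Local Notation mu := (lebesgue_rV R n).
Implicit Types (f g : 'rV[R]_n -> R).

Lemma measurable_natr_of_bool d (T : measurableType d) (b : T -> bool) :
  measurable_fun setT b -> measurable_fun setT (fun x => (b x)%:R : R).
Proof.
move=> mb; have -> : (fun x => (b x)%:R : R) = (fun x => if b x then 1 else 0).
  by apply/funext => x; case: (b x).
exact: measurable_fun_ifT.
Qed.

Lemma ge0_integralD_rV f g :
  measurable_fun setT f -> measurable_fun setT g ->
  (forall y, 0 <= f y) -> (forall y, 0 <= g y) ->
  (\int[mu]_y (f y + g y)%:E = \int[mu]_y (f y)%:E + \int[mu]_y (g y)%:E)%E.
Proof.
move=> mf mg f0 g0; under eq_integral do rewrite EFinD.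
rewrite ge0_integralD//.
- by move=> y _; rewrite lee_fin.
- exact/measurable_EFinP.
- by move=> y _; rewrite lee_fin.
- exact/measurable_EFinP.
Qed.

Lemma ge0_integralZl_rV (c : R) f : 0 <= c ->
  measurable_fun setT f -> (forall y, 0 <= f y) ->
  (\int[mu]_y (c * f y)%:E = c%:E * \int[mu]_y (f y)%:E)%E.
Proof.
move=> c0 mf f0; under eq_integral do rewrite EFinM.
rewrite ge0_integralZl//; first exact/measurable_EFinP.
by move=> y _; rewrite lee_fin.
Qed.

Lemma ge0_le_integral_rV f g :
  measurable_fun setT f -> measurable_fun setT g ->
  (forall y, 0 <= f y) -> (forall y, f y <= g y) ->
  (\int[mu]_y (f y)%:E <= \int[mu]_y (g y)%:E)%E.
Proof.
move=> mf mg f0 fg; apply: ge0_le_integral => //.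
- by move=> y _; rewrite lee_fin.
- exact/measurable_EFinP.
- exact/measurable_EFinP.
- by move=> y _; rewrite lee_fin.
Qed.

(** The bound is allowed to fail at one point because a kernel with pole [x] has the default value 0
    there. *)
Lemma integral_rV_ge_cst f (x : 'rV[R]_n) (c : R) (A : set 'rV[R]_n) : (0 < n)%N ->
  measurable A -> measurable_fun setT f -> (forall y, 0 <= f y) -> 0 <= c ->
  (forall y, A y -> y != x -> c <= f y) ->
  (c%:E * mu A <= \int[mu]_y (f y)%:E)%E.
Proof.
move=> n0 mA mf f0 c0 cf.
have mI : measurable_fun setT (\1_A : 'rV[R]_n -> R) by exact: measurable_indic.
have I0 y : 0 <= (\1_A : 'rV[R]_n -> R) y by rewrite indicE ler0n.
have -> : (c%:E * mu A = \int[mu]_y (c * \1_A y)%:E)%E.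
  rewrite ge0_integralZl_rV//.
  by rewrite integral_indic// setIT.
apply: (@ge0_le_integral_rV_but _ _ _ _ x) => //.
- exact: measurable_funM.
- by move=> y; rewrite mulr_ge0.
move=> y _ yx; rewrite indicE; case: (boolP (y \in A)) => [|_].
  by rewrite inE => Ay; rewrite mulr1 cf.
by rewrite mulr0.
Qed.

(* Inversion folds the exterior of the ball of radius l onto its interior; the
   sphere is counted once. *)
Lemma integral_fold_inversion l f : (0 < n)%N -> 0 < l ->
  measurable_fun setT f -> (forall y, 0 <= f y) ->
  (\int[mu]_y (f y)%:E =
   \int[mu]_y ((enorm y <= l)%R%:R * f y +
     (enorm y < l)%R%:R * (f (inversion l y) * (l / enorm y) ^+ (2 * n)))%:E)%E.
Proof.
move=> n0 l0 mf f0.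
have mle : measurable_fun setT (fun y : 'rV[R]_n => (enorm y <= l)%R%:R : R).
  apply: measurable_natr_of_bool; apply: measurable_fun_ler => //.
  exact: measurable_enorm.
have mlt : measurable_fun setT (fun y : 'rV[R]_n => (enorm y < l)%R%:R : R).
  apply: measurable_natr_of_bool; apply: measurable_fun_ltr => //.
  exact: measurable_enorm.
have mgt : measurable_fun setT (fun y : 'rV[R]_n => (l < enorm y)%R%:R : R).
  apply: measurable_natr_of_bool; apply: measurable_fun_ltr => //.
  exact: measurable_enorm.
have mT : measurable_fun setT (fun y : 'rV[R]_n => (l / enorm y) ^+ (2 * n)).
  apply: measurable_funX; apply: measurable_funM => //.
  apply: measurable_fun_invr; first exact: measurable_enorm.
  by move=> x; exact: enorm_ge0.
have T0 (y : 'rV[R]_n) : 0 <= (l / enorm y) ^+ (2 * n).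
  by rewrite exprn_ge0// divr_ge0 ?enorm_ge0// ltW.
have mfi := measurableT_comp mf (measurable_inversion l).
have mlf := measurable_funM mle mf.
have mgf := measurable_funM mgt mf.
have mltf := measurable_funM mlt (measurable_funM mfi mT).
transitivity (\int[mu]_y ((enorm y <= l)%R%:R * f y + (l < enorm y)%R%:R * f y)%:E)%E.
  apply: eq_integral => y _; congr (_%:E).
  by case: leP => _; rewrite !(mul0r, mul1r, add0r, addr0).
rewrite (ge0_integralD_rV mlf mgf); last 2 first.
- by move=> y; rewrite mulr_ge0.
- by move=> y; rewrite mulr_ge0.
rewrite (ge0_integralD_rV mlf mltf); last 2 first.
- by move=> y; rewrite mulr_ge0.
- by move=> y; rewrite /= !mulr_ge0.
congr (_ + _)%E.
rewrite (ge0_integral_inversion n0 l0 mgf); last by move=> y; rewrite mulr_ge0.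
apply: ge0_eq_integral_rV_but0 => //=.
- apply: measurable_funM => //.
  exact: (measurableT_comp mgf (measurable_inversion l)).
- by move=> y; rewrite !mulr_ge0.
- by move=> y; rewrite !mulr_ge0.
move=> y y0; rewrite -mulrA; congr ((nat_of_bool _)%:R * _).
have ny : 0 < enorm y by rewrite enorm_gt0.
by rewrite enorm_inversion ltr_pdivlMr// expr2 ltr_pM2l.
Qed.

End real_integrals.

(** * The method of scaling spheres *)

Section scaling_spheres.
Context {R : realType} {n k : nat} {a p C : R} {u : 'rV[R]_n -> R}.
Hypothesis k0 : (0 < k)%N.
Hypothesis kn : (k < n)%N.
Hypothesis C0 : 0 < C.
Hypothesis p0 : 0 < p.
Hypothesis cu : continuous u.
Local Notation mu := (lebesgue_rV R n).

(** The exponent [k] stands for [n - 2m]. At [y = x] the value is 0 by default, hence the condition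
    [y != x] in pointwise kernel estimates. *)
Definition riesz (x y : 'rV[R]_n) : R := C / enorm (x - y) ^+ k.

(** The nonlinearity of the Hardy--Henon equation [(-Delta)^m u = |x|^a u^p]. *)
Definition henon (y : 'rV[R]_n) : R := enorm y `^ a * u y `^ p.

Hypothesis henon_eq : forall x, ((u x)%:E = \int[mu]_y (riesz x y * henon y)%:E)%E.

Let n0 : (0 < n)%N. Proof. exact: leq_ltn_trans kn. Qed.

Lemma riesz_ge0 x y : 0 <= riesz x y.
Proof. by rewrite divr_ge0 ?exprn_ge0 ?enorm_ge0// ltW. Qed.

Lemma henon_ge0 y : 0 <= henon y.
Proof. by rewrite mulr_ge0// powR_ge0. Qed.

Lemma measurable_weight : measurable_fun [set: 'rV[R]_n] (fun y => enorm y `^ a).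
Proof. exact: (measurableT_comp (@measurable_powR R a) measurable_enorm). Qed.

Lemma measurable_henon : measurable_fun [set: 'rV[R]_n] henon.
Proof.
apply: measurable_funM; first exact: measurable_weight.
exact: (measurableT_comp (@measurable_powR R p) (continuous_measurable_rV cu)).
Qed.

Lemma measurable_riesz x : measurable_fun [set: 'rV[R]_n] (riesz x).
Proof.
apply: measurable_funM => //; apply: measurable_fun_invr => [|y].
  by apply: measurable_funX; exact: measurable_enormB.
by rewrite exprn_ge0 ?enorm_ge0.
Qed.

Let unit_vector : exists e : 'rV[R]_n, enorm e = 1.
Proof.
exists (delta_mx 0 (Ordinal n0)); rewrite /enorm (bigD1 (Ordinal n0))//= big1.
  by rewrite mxE !eqxx expr1n addr0 sqrtr1.
by move=> i /negbTE h; rewrite mxE h andbF expr0n.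
Qed.

(** By continuity [u] exceeds [u x0 / 2] near [x0]. A small ball there already contributes a
    positive amount to the integral for [u x]. *)
Lemma solution_gt0 x0 : 0 < u x0 -> forall x, 0 < u x.
Proof.
move=> ux0 x.
have /nbhs_ballP[r /= r0 hr] : \forall y \near x0, u x0 / 2 < u y.
  have h : u x0 / 2 < u x0 by lra.
  by have := cvgr_gt _ (@cu x0) _ h; apply; exact: nbhs_filter.
have hrE y : enorm (x0 - y) < r -> u x0 / 2 < u y.
  move=> yr; apply: hr; split=> // i j; rewrite /ball /= !ord1.
  by apply: le_lt_trans yr; have := coord_le_enorm (x0 - y) j; rewrite !mxE.
(* The centre is moved off the origin, where the weight [|y|^a] may vanish or blow up. *)
have [x1 x10 x1r] : exists2 x1 : 'rV[R]_n, x1 != 0 & enorm (x0 - x1) < r.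
  have [->|x00] := eqVneq x0 0; last by exists x0 => //; rewrite subrr enorm0.
  have [e e1] := unit_vector.
  exists ((r / 2) *: e).
    by rewrite -enorm_gt0 enormZ e1 mulr1 normr_gt0 gt_eqF// divr_gt0.
  by rewrite sub0r enormN enormZ e1 mulr1 gtr0_norm ?divr_gt0//; lra.
have nx1 : 0 < enorm x1 by rewrite enorm_gt0.
(* The first bound keeps the ball where [u > u x0 / 2], the second keeps [|y|] comparable to
   [|x1|]. *)
pose s := Num.min (r - enorm (x0 - x1)) (enorm x1 / 2).
have s0 : 0 < s by rewrite lt_min subr_gt0 x1r divr_gt0.
pose B := [set y | enorm (x1 - y) < s].
have mB : measurable B by exact: measurable_ball_rV.
pose S := enorm x + 2 * enorm x1.
have S0 : 0 < S by rewrite ltr_wpDl ?enorm_ge0// mulr_gt0.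
pose w := ((enorm x1 / 2) `^ (- a) + (2 * enorm x1) `^ (- a))^-1.
have w0 : 0 < w by rewrite invr_gt0 addr_gt0// powR_gt0 ?mulr_gt0 ?divr_gt0.
pose c := C / S ^+ k * (w * (u x0 / 2) `^ p).
have c0 : 0 < c.
  by rewrite mulr_gt0 ?divr_gt0 ?exprn_gt0// mulr_gt0// powR_gt0// divr_gt0.
rewrite -lte_fin henon_eq.
apply: (@lt_le_trans _ _ (c%:E * mu B)%E).
  rewrite [mu B]volume_ball// -EFinM lte_fin; apply: mulr_gt0 => //.
  by apply: mulr_gt0; [rewrite exprn_gt0|exact: unit_volume_gt0].
apply: (@integral_rV_ge_cst _ _ _ x) => //.
- by apply: measurable_funM; [exact: measurable_riesz|exact: measurable_henon].
- by move=> y; exact: mulr_ge0 (riesz_ge0 _ _) (henon_ge0 _).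
- exact: ltW.
move=> y; rewrite /B /= lt_min => /andP[yr yx1] yx.
have ylow : enorm x1 / 2 <= enorm y by have := lerB_enorm x1 y; lra.
have yup : enorm y <= 2 * enorm x1.
  have := lerB_enorm y x1; rewrite enorm_distC; lra.
apply: ler_pM.
- by rewrite divr_ge0 ?(ltW C0)// exprn_ge0// ltW.
- by rewrite mulr_ge0 ?powR_ge0// ltW.
- have dxy : 0 < enorm (x - y) by rewrite enorm_gt0 subr_eq0 eq_sym.
  have h2 : enorm (x - y) <= S by have := ler_enormB x y; rewrite /S; lra.
  rewrite ler_pM2l// lef_pV2 ?posrE ?exprn_gt0//.
  by apply: lerXn2r; rewrite ?nnegrE ?enorm_ge0// ltW.
- apply: ler_pM; rewrite ?powR_ge0 ?(ltW w0)//.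
    by apply: powR_ge_ends; [rewrite divr_gt0|rewrite ylow yup].
  have huy : u x0 / 2 < u y.
    apply: hrE; have := ler_enormD (x0 - x1) (x1 - y).
    by rewrite addrA subrK; lra.
  have u20 : 0 <= u x0 / 2 by rewrite divr_ge0// ltW.
  by apply: ge0_ler_powR; rewrite ?nnegrE ?(ltW p0) ?(ltW huy) ?(le_trans u20 (ltW huy)).
Qed.

(** * The Kelvin transform and the folded integral equations *)

Hypothesis u0 : forall x, 0 < u x.

(* [riesz_kelvin l] is the kernel that represents [kelvin l] as an integral of
   [henon]; [riesz_kelvin l x] and [riesz x] are exchanged by the inversion. *)
Definition kelvin l (x : 'rV[R]_n) : R := (l / enorm x) ^+ k * u (inversion l x).

Definition riesz_kelvin l (x y : 'rV[R]_n) : R :=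
  C / (enorm x / l * enorm (inversion l x - y)) ^+ k.

(** The Jacobian of the inversion has exponent [2n]; the transformed kernel takes up [k] of it and
    the rest stays with the source. *)
Definition henon_kelvin l (y : 'rV[R]_n) : R :=
  henon (inversion l y) * (l / enorm y) ^+ (2 * n - k).

(* With k = n - 2m, [0 < tau] is the subcriticality of p. *)
Let tau : R := (2 * n - k)%N%:R + 2 * a - k%:R * p.

Lemma riesz_kelvin_ge0 l x y : 0 < l -> 0 <= riesz_kelvin l x y.
Proof.
move=> l0; rewrite divr_ge0 ?(ltW C0)// exprn_ge0// mulr_ge0 ?enorm_ge0//.
by rewrite divr_ge0 ?enorm_ge0// ltW.
Qed.

Lemma henon_kelvin_ge0 l y : 0 < l -> 0 <= henon_kelvin l y.
Proof.
by move=> l0; rewrite mulr_ge0 ?henon_ge0// exprn_ge0// divr_ge0 ?enorm_ge0// ltW.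
Qed.

Lemma kelvin_gt0 l x : 0 < l -> x != 0 -> 0 < kelvin l x.
Proof.
by rewrite -enorm_gt0 => l0 x0; rewrite mulr_gt0// exprn_gt0// divr_gt0.
Qed.

Lemma riesz_kelvinE l x y :
  riesz_kelvin l x y = (l / enorm x) ^+ k * riesz (inversion l x) y.
Proof.
rewrite /riesz_kelvin /riesz exprMn invfM mulrCA; congr (_ * _).
by rewrite -exprVn invfM invrK mulrC.
Qed.

Lemma measurable_riesz_kelvin l x : measurable_fun [set: 'rV[R]_n] (riesz_kelvin l x).
Proof.
have -> : riesz_kelvin l x = fun y => (l / enorm x) ^+ k * riesz (inversion l x) y.
  by apply/funext => y; exact: riesz_kelvinE.
by apply: measurable_funM => //; exact: measurable_riesz.
Qed.

Lemma measurable_henon_kelvin l : measurable_fun [set: 'rV[R]_n] (henon_kelvin l).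
Proof.
apply: measurable_funM.
  exact: (measurableT_comp measurable_henon (measurable_inversion l)).
apply: measurable_funX; apply: measurable_funM => //.
apply: measurable_fun_invr; first exact: measurable_enorm.
by move=> x; exact: enorm_ge0.
Qed.

Let mle l : measurable_fun setT (fun y : 'rV[R]_n => (enorm y <= l)%R%:R : R).
Proof.
apply: measurable_natr_of_bool; apply: measurable_fun_ler => //.
exact: measurable_enorm.
Qed.

Let mlt l : measurable_fun setT (fun y : 'rV[R]_n => (enorm y < l)%R%:R : R).
Proof.
apply: measurable_natr_of_bool; apply: measurable_fun_ltr => //.
exact: measurable_enorm.
Qed.

Lemma riesz_inversion l x y : 0 < l -> x != 0 -> y != 0 ->
  riesz x (inversion l y) * (l / enorm y) ^+ k = riesz_kelvin l x y.
Proof.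
move=> l0 x0 y0; rewrite /riesz /riesz_kelvin inversion_dist_sym//.
by rewrite [in RHS]exprMn [in RHS]invfM -[in RHS]exprVn invf_div mulrA mulrAC.
Qed.

Lemma riesz_kelvin_inversion l x y : 0 < l -> x != 0 -> y != 0 ->
  riesz_kelvin l x (inversion l y) * (l / enorm y) ^+ k = riesz x y.
Proof.
move=> l0 x0 y0; rewrite /riesz /riesz_kelvin inversion_dist//.
have nx : 0 < enorm x by rewrite enorm_gt0.
have ny : 0 < enorm y by rewrite enorm_gt0.
rewrite (_ : _ / l * _ = l / enorm y * enorm (x - y)); last by field; rewrite !gt_eqF.
rewrite exprMn invfM mulrA mulrAC mulfVK// expf_neq0// mulf_neq0 ?invr_eq0 ?gt_eqF//.
Qed.

Let measurable_fold l (K K' : 'rV[R]_n -> R) :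
  measurable_fun setT K -> measurable_fun setT K' ->
  measurable_fun setT (fun y => (enorm y <= l)%R%:R * (K y * henon y) +
    (enorm y < l)%R%:R * (K' y * henon_kelvin l y)).
Proof.
move=> mK mK'; apply: measurable_funD; apply: measurable_funM => //.
  apply: measurable_funM => //; exact: measurable_henon.
apply: measurable_funM => //; exact: measurable_henon_kelvin.
Qed.

Let fold_ge0 l (K K' : 'rV[R]_n -> R) y : 0 < l -> 0 <= K y -> 0 <= K' y ->
  0 <= (enorm y <= l)%R%:R * (K y * henon y) +
    (enorm y < l)%R%:R * (K' y * henon_kelvin l y).
Proof.
move=> l0 K0 K'0; apply: addr_ge0; apply: mulr_ge0 => //; apply: mulr_ge0 => //.
  exact: henon_ge0.
exact: henon_kelvin_ge0.
Qed.

Let integral_fold l (K K' : 'rV[R]_n -> R) : 0 < l ->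
  measurable_fun setT K -> measurable_fun setT K' ->
  (forall y, 0 <= K y) -> (forall y, 0 <= K' y) ->
  (forall y, y != 0 -> K (inversion l y) * (l / enorm y) ^+ k = K' y) ->
  (\int[mu]_y (K y * henon y)%:E =
   \int[mu]_y ((enorm y <= l)%R%:R * (K y * henon y) +
    (enorm y < l)%R%:R * (K' y * henon_kelvin l y))%:E)%E.
Proof.
move=> l0 mK mK' K0 K'0 KK'.
have mKh : measurable_fun setT (fun y => K y * henon y).
  by apply: measurable_funM => //; exact: measurable_henon.
rewrite (integral_fold_inversion n0 l0)//; last first.
  by move=> y; rewrite mulr_ge0 ?henon_ge0.
apply: ge0_eq_integral_rV_but0 => //.
- apply: measurable_funD; first exact: measurable_funM.
  apply: measurable_funM => //; apply: measurable_funM.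
    exact: (measurableT_comp mKh (measurable_inversion l)).
  apply: measurable_funX; apply: measurable_funM => //.
  apply: measurable_fun_invr; first exact: measurable_enorm.
  by move=> x; exact: enorm_ge0.
- exact: measurable_fold.
- move=> y; have h0 z : 0 <= K z * henon z by rewrite mulr_ge0 ?henon_ge0.
  by rewrite addr_ge0// mulr_ge0// mulr_ge0// exprn_ge0// divr_ge0 ?enorm_ge0// ltW.
- by move=> y; exact: fold_ge0.
move=> y y0; congr (_ + _ * _); rewrite -KK'// /henon_kelvin.
have -> : (2 * n = k + (2 * n - k))%N.
  by rewrite subnKC// (leq_trans (ltnW kn))// leq_pmull.
by rewrite exprD addKn; ring.
Qed.

(** Subtracting [kelvin_eq_fold] formally leaves the integral of [(riesz - riesz_kelvin) (henon -
    henon_kelvin)] over the ball; on the sphere the two kernels agree. *)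
Lemma henon_eq_fold l x : 0 < l -> x != 0 ->
  ((u x)%:E = \int[mu]_y ((enorm y <= l)%R%:R * (riesz x y * henon y) +
    (enorm y < l)%R%:R * (riesz_kelvin l x y * henon_kelvin l y))%:E)%E.
Proof.
move=> l0 x0; rewrite henon_eq; apply: integral_fold => //.
- exact: measurable_riesz.
- exact: measurable_riesz_kelvin.
- by move=> y; exact: riesz_ge0.
- by move=> y; exact: riesz_kelvin_ge0.
- by move=> y y0; exact: riesz_inversion.
Qed.

Lemma kelvin_eq_fold l x : 0 < l -> x != 0 ->
  ((kelvin l x)%:E = \int[mu]_y ((enorm y <= l)%R%:R * (riesz_kelvin l x y * henon y) +
    (enorm y < l)%R%:R * (riesz x y * henon_kelvin l y))%:E)%E.
Proof.
move=> l0 x0; rewrite -integral_fold//; last 5 first.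
- exact: measurable_riesz_kelvin.
- exact: measurable_riesz.
- by move=> y; exact: riesz_kelvin_ge0.
- by move=> y; exact: riesz_ge0.
- by move=> y y0; exact: riesz_kelvin_inversion.
rewrite /kelvin EFinM henon_eq -ge0_integralZl_rV.
- by apply: eq_integral => y _; rewrite riesz_kelvinE mulrA.
- by rewrite exprn_ge0// divr_ge0 ?enorm_ge0// ltW.
- by apply: measurable_funM; [exact: measurable_riesz|exact: measurable_henon].
- by move=> y; rewrite mulr_ge0 ?riesz_ge0 ?henon_ge0.
Qed.

(** With [T = l / |y|], the weight gives [T^(2a)], the rest of the Jacobian [T^(2n-k)], and passing
    from [u] to [kelvin l] costs [T^(kp)]. *)
Lemma henon_kelvinE l y : 0 < l -> y != 0 ->
  henon_kelvin l y = (l / enorm y) `^ tau * (enorm y `^ a * kelvin l y `^ p).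
Proof.
rewrite -enorm_gt0 => l0 y0; rewrite /henon_kelvin /henon /kelvin enorm_inversion.
set T := l / enorm y; set v := u (inversion l y).
have T0 : 0 < T by rewrite divr_gt0.
have -> : l ^+ 2 / enorm y = T ^+ 2 * enorm y by rewrite /T; field; rewrite gt_eqF.
have v0 : 0 <= v by exact: ltW (u0 _).
clearbody T v; rewrite !powRM ?exprn_ge0 ?enorm_ge0 ?(ltW T0)//.
rewrite -!powR_mulrn ?(ltW T0)// -!powRrM.
have TD (s t : R) : T `^ s * T `^ t = T `^ (s + t).
  by rewrite powRD//; apply/implyP => _; rewrite gt_eqF.
rewrite [LHS](_ : _ = T `^ (2 * a) * T `^ (2 * n - k)%N%:R * (enorm y `^ a * v `^ p)).
  rewrite [RHS](_ : _ = T `^ tau * T `^ (k%:R * p) * (enorm y `^ a * v `^ p)).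
    by rewrite !TD /tau; congr (_ `^ _ * _); ring.
  by ring.
by rewrite [T `^ a * T `^ a]TD (_ : a + a = 2 * a); ring.
Qed.

(** * Comparison of the solution with its Kelvin transform *)

Hypothesis tau0 : 0 < tau.

(** Subcriticality enters here: [l / |y| >= 1] is raised to the positive power [tau]. *)
Lemma henon_kelvin_ge l y : 0 < l -> y != 0 -> enorm y <= l ->
  enorm y `^ a * kelvin l y `^ p <= henon_kelvin l y.
Proof.
move=> l0 y0 yl; rewrite henon_kelvinE// ler_peMl ?mulr_ge0 ?powR_ge0//.
have -> : 1 = (l / enorm y) `^ 0 :> R by rewrite powRr0.
by apply: ler_powR; rewrite ?(ltW tau0)// ler_pdivlMr ?mul1r// enorm_gt0.
Qed.

Lemma riesz_kelvin_le l x y : 0 < l -> x != 0 -> enorm x < l -> enorm y <= l ->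
  y != x -> riesz_kelvin l x y <= riesz x y.
Proof.
move=> l0 x0 xl yl yx; rewrite ler_pM2l// lef_pV2; last 2 first.
- rewrite posrE exprn_gt0//; apply: (lt_le_trans _ (inversion_dist_le l0 x0 xl yl)).
  by rewrite enorm_gt0 subr_eq0 eq_sym.
- by rewrite posrE exprn_gt0// enorm_gt0 subr_eq0 eq_sym.
apply: lerXn2r; rewrite ?nnegrE ?enorm_ge0//; last exact: inversion_dist_le.
by rewrite mulr_ge0 ?enorm_ge0// divr_ge0 ?enorm_ge0// ltW.
Qed.

Lemma riesz_kelvin_sphere l x y : 0 < l -> x != 0 -> enorm y = l ->
  riesz_kelvin l x y = riesz x y.
Proof. by move=> l0 x0 yl; rewrite /riesz_kelvin -inversion_dist_sphere. Qed.

(** The folded representations are compared integrand by integrand, with no subtraction of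
    integrals. Where [u <= kelvin l] the source difference has the good sign; elsewhere [y] lies in
    [D] and the Lipschitz bound gives at most [L S |y|^a]. *)
Lemma le_kelvin_add l x (M L S : R) (D : set 'rV[R]_n) :
  0 < l -> x != 0 -> enorm x < l -> 0 <= S -> 0 <= L -> measurable D ->
  (forall y, enorm y < l -> u y <= M) ->
  (forall v w, 0 <= v -> v <= w -> w <= M -> w `^ p - v `^ p <= L * (w - v)) ->
  (forall y, y != 0 -> enorm y < l -> kelvin l y < u y -> D y) ->
  (forall y, y != 0 -> enorm y < l -> u y <= kelvin l y + S) ->
  ((u x)%:E <= (kelvin l x)%:E +
     (L * S)%:E * \int[mu]_y (\1_D y * (riesz x y * enorm y `^ a))%:E)%E.
Proof.
move=> l0 x0 xl S0 L0 mD uM Llip hD hS.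
have mI : measurable_fun setT (\1_D : 'rV[R]_n -> R) by exact: measurable_indic.
have I0 y : 0 <= (\1_D : 'rV[R]_n -> R) y by rewrite indicE ler0n.
have mK : measurable_fun setT (fun y => \1_D y * (riesz x y * enorm y `^ a)).
  apply: measurable_funM => //; apply: measurable_funM; first exact: measurable_riesz.
  exact: measurable_weight.
have K0 y : 0 <= \1_D y * (riesz x y * enorm y `^ a).
  by rewrite mulr_ge0// mulr_ge0 ?riesz_ge0 ?powR_ge0.
rewrite (henon_eq_fold l0 x0) (kelvin_eq_fold l0 x0).
rewrite -ge0_integralZl_rV ?mulr_ge0//.
rewrite -ge0_integralD_rV; last 4 first.
- by apply: measurable_fold; [exact: measurable_riesz_kelvin|exact: measurable_riesz].
- exact: measurable_funM.
- by move=> y; apply: fold_ge0; rewrite // ?riesz_ge0 ?riesz_kelvin_ge0.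
- by move=> y; exact: mulr_ge0 (mulr_ge0 L0 S0) (K0 y).
apply: (@ge0_le_integral_rV_but _ _ _ _ x) => //.
- by apply: measurable_fold; [exact: measurable_riesz|exact: measurable_riesz_kelvin].
- apply: measurable_funD; last exact: measurable_funM.
  by apply: measurable_fold; [exact: measurable_riesz_kelvin|exact: measurable_riesz].
- by move=> y; apply: fold_ge0; rewrite // ?riesz_ge0 ?riesz_kelvin_ge0.
- move=> y; rewrite addr_ge0//; last exact: mulr_ge0 (mulr_ge0 L0 S0) (K0 y).
  by apply: fold_ge0; rewrite // ?riesz_ge0 ?riesz_kelvin_ge0.
move=> y y0 yx.
have h0 := K0 y; have LS0 : 0 <= L * S by rewrite mulr_ge0.
have [yl|yl|yl] := ltgtP (enorm y) l; rewrite !(mul1r, mul0r, addr0, add0r).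
- have hK := riesz_kelvin_le l0 x0 xl (ltW yl) yx.
  have hK0 := @riesz_kelvin_ge0 l x y l0.
  have hg := henon_kelvin_ge l0 y0 (ltW yl).
  have hw := powR_ge0 (enorm y) a.
  (* The claim amounts to a bound on [(riesz - riesz_kelvin) (henon - henon_kelvin)], and the first
     factor lies between 0 and [riesz]. *)
  suff hfg : henon y - henon_kelvin l y <= L * S * (\1_D y * enorm y `^ a).
    have h1 : 0 <= L * S * (\1_D y * enorm y `^ a) by rewrite !mulr_ge0.
    have -> : L * S * (\1_D y * (riesz x y * enorm y `^ a)) =
        riesz x y * (L * S * (\1_D y * enorm y `^ a)) by ring.
    move: (L * S * (\1_D y * _)) hfg h1 => h hfg h1.
    nra.
  apply: (@le_trans _ _ (enorm y `^ a * (u y `^ p - kelvin l y `^ p))).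
    by rewrite /henon; lra.
  have kel0 := kelvin_gt0 l0 y0.
  have [uk|ku] := leP (u y) (kelvin l y).
    apply: (@le_trans _ _ 0); last by rewrite !mulr_ge0.
    rewrite mulr_ge0_le0// subr_le0.
    by apply: ge0_ler_powR; rewrite ?nnegrE ?(ltW p0) ?(ltW kel0) ?(ltW (u0 y)).
  have Dy := hD _ y0 yl ku.
  rewrite indicE mem_set// mul1r [leRHS]mulrC ler_wpM2l//.
  apply: (le_trans (Llip _ _ (ltW kel0) (ltW ku) (uM _ yl))).
  by rewrite ler_wpM2l// lerBlDl; exact: hS.
- by rewrite mulr_ge0.
- by rewrite riesz_kelvin_sphere// lerDl mulr_ge0.
Qed.


Lemma ball_bounds r : 0 <= r -> exists m M, 0 < m /\
  forall x, enorm x <= r -> m <= u x <= M.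
Proof.
move=> r0; pose B := [set x : 'rV[R]_n | enorm x <= r].
have B0 : B !=set0 by exists 0; rewrite /B /= enorm0.
have cB : compact B := @enorm_closed_ball_compact R n r.
have cuB : {within B, continuous u} by exact: continuous_subspaceT.
have [c _ hc] := compact_EVT_min B0 cB cuB.
have [d _ hd] := compact_EVT_max B0 cB cuB.
exists (u c), (u d); split=> // x xr.
by rewrite hc ?inE// hd// inE.
Qed.

Lemma henon_ge r s : 0 < r -> r <= s ->
  exists2 c, 0 < c & forall y, r <= enorm y <= s -> c <= henon y.
Proof.
move=> r0 rs; have s0 := lt_le_trans r0 rs.
have [m [M [m0 hm]]] := ball_bounds (ltW s0).
exists ((r `^ (- a) + s `^ (- a))^-1 * m `^ p).
  by rewrite mulr_gt0 ?powR_gt0// invr_gt0 addr_gt0 ?powR_gt0.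
move=> y hy; apply: ler_pM; rewrite ?powR_ge0 ?invr_ge0 ?addr_ge0 ?powR_ge0//.
  exact: powR_ge_ends.
have /andP[my _] := hm _ (proj2 (andP hy)).
by apply: ge0_ler_powR; rewrite ?nnegrE ?(ltW p0) ?(ltW m0) ?(ltW (u0 y)).
Qed.

(** With [t = d / q] the right-hand side is [C / d^k (1 - t^k)], and
    [1 - t^k >= 1 - t >= (1 - t^2) / 2]. This turns a gap between squared distances into a gap
    between kernels. *)
Lemma inv_expr_gap (d q D Q delta : R) : 0 < d -> d <= q -> d <= D -> 0 <= delta ->
  d ^+ 2 + delta <= q ^+ 2 -> q ^+ 2 <= Q ->
  C / D ^+ k * (delta / (2 * Q)) <= C / d ^+ k - C / q ^+ k.
Proof.
move=> d0 dq dD delta0 hdq qQ.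
have q0 := lt_le_trans d0 dq; have D0 := lt_le_trans d0 dD.
have Q0 : 0 < Q by apply: (lt_le_trans _ qQ); rewrite exprn_gt0.
pose t := d / q.
have t0 : 0 <= t by rewrite divr_ge0// ltW.
have t1 : t <= 1 by rewrite ler_pdivrMr// mul1r.
have -> : C / q ^+ k = C / d ^+ k * t ^+ k.
  by rewrite /t expr_div_n; field; rewrite !expf_neq0 ?gt_eqF.
rewrite -[X in _ <= X - _]mulr1 -mulrBr; apply: ler_pM.
- by rewrite divr_ge0 ?(ltW C0)// exprn_ge0// ltW.
- by rewrite divr_ge0// mulr_ge0// ltW.
- rewrite ler_pM2l// lef_pV2 ?posrE ?exprn_gt0//.
  by apply: lerXn2r; rewrite ?nnegrE ?(ltW d0) ?(ltW D0).
have tk : t ^+ k <= t.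
  by rewrite -(prednK k0) exprS ler_piMr// exprn_ile1.
apply: (@le_trans _ _ ((1 - t ^+ 2) / 2)); last first.
  have : 0 <= (1 - t) ^+ 2 by exact: sqr_ge0.
  by rewrite expr2; lra.
have -> : 1 - t ^+ 2 = (q ^+ 2 - d ^+ 2) / q ^+ 2.
  by rewrite /t expr_div_n; field; rewrite gt_eqF.
rewrite [leLHS](_ : _ = delta / Q / 2); last by field; rewrite gt_eqF.
rewrite ler_pM2r ?invr_gt0//; apply: ler_pM => //.
- by rewrite invr_ge0 ltW.
- by rewrite lerBrDl.
- by rewrite lef_pV2 ?posrE ?exprn_gt0.
Qed.

Lemma riesz_gap l r : 0 < l -> 0 < r -> r < l -> exists2 c, 0 < c &
  forall x y, x != 0 -> enorm x <= r -> enorm y < l / 2 -> y != x ->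
  riesz_kelvin l x y + c <= riesz x y.
Proof.
move=> l0 r0 rl.
(* By [inversion_distl] the squared distances differ by at least [(l^2 - r^2) 3/4], as
   [|y| < l / 2], and by at most [l^2]. Moreover [|x - y| <= 2 l], which gives [5 l^2] for the
   larger square. *)
exists (C / (2 * l) ^+ k * ((l ^+ 2 - r ^+ 2) * (3 / 4) / (2 * (5 * l ^+ 2)))).
  have h : 0 < l ^+ 2 - r ^+ 2 by rewrite subr_gt0 ltrXn2r// ?nnegrE ltW.
  rewrite mulr_gt0// ?divr_gt0// ?exprn_gt0 ?mulr_gt0//.
move=> x y x0 xr yl yx; rewrite -lerBrDl.
have xl := le_lt_trans xr rl.
have yl' : enorm y < l by lra.
have ex := enorm_ge0 x; have ey := enorm_ge0 y.
have x2 : enorm x ^+ 2 <= r ^+ 2 by apply: lerXn2r; rewrite ?nnegrE ?(ltW r0).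
have r2 : r ^+ 2 < l ^+ 2 by rewrite ltrXn2r// ?nnegrE ltW.
have y2 : enorm y ^+ 2 <= l ^+ 2 / 4.
  have -> : l ^+ 2 / 4 = (l / 2) ^+ 2 by field.
  by apply: lerXn2r; rewrite ?nnegrE ?divr_ge0 ?(ltW l0) ?(ltW yl).
have l2 : 0 < l ^+ 2 by rewrite exprn_gt0.
have hd : enorm (x - y) <= 2 * l by have := ler_enormB x y; lra.
have hq := inversion_distl y l0 x0.
have dE : (l ^+ 2 - enorm x ^+ 2) * (l ^+ 2 - enorm y ^+ 2) / l ^+ 2 =
    (l ^+ 2 - enorm x ^+ 2) * (1 - enorm y ^+ 2 / l ^+ 2).
  by field; rewrite gt_eqF.
have yl2 : enorm y ^+ 2 / l ^+ 2 <= 1 / 4 by rewrite ler_pdivrMr//; lra.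
have yl2' : 0 <= enorm y ^+ 2 / l ^+ 2 by rewrite divr_ge0// ?sqr_ge0.
have x2' := sqr_ge0 (enorm x).
apply: inv_expr_gap => //.
- by rewrite enorm_gt0 subr_eq0 eq_sym.
- exact: (inversion_dist_le l0 x0 xl (ltW yl')).
- by rewrite mulr_ge0// subr_ge0 ltW.
- rewrite hq dE lerD2l; nra.
- rewrite hq dE.
  have : enorm (x - y) ^+ 2 <= (2 * l) ^+ 2.
    by apply: lerXn2r; rewrite ?nnegrE ?enorm_ge0// mulr_ge0// ltW.
  rewrite exprMn; nra.
Qed.

(** All contributions to [kelvin l x - u x] are nonnegative, and the annulus [l/4 <= |y| < l/2]
    yields a definite gain: a kernel gap by [riesz_gap] and a source gap because
    [(l / |y|)^tau >= 2^tau > 1]. *)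
Lemma kelvin_ge_add l r : 0 < l -> 0 < r -> r < l ->
  (forall y, y != 0 -> enorm y < l -> u y <= kelvin l y) ->
  exists2 c, 0 < c & forall x, x != 0 -> enorm x <= r -> u x + c <= kelvin l x.
Proof.
move=> l0 r0 rl hl.
have [cK cK0 hK] := riesz_gap l0 r0 rl.
have l4 : 0 < l / 4 by rewrite divr_gt0.
have l42 : l / 4 <= l / 2 by lra.
have [cf cf0 hf] := henon_ge l4 l42.
pose A := [set y : 'rV[R]_n | l / 4 <= enorm y < l / 2].
have mA : measurable A by exact: measurable_annulus.
pose v := ((l / 2) ^+ n - (l / 4) ^+ n) * @unit_volume R n.
have v0 : 0 < v.
  rewrite mulr_gt0 ?unit_volume_gt0// subr_gt0 ltrXn2r ?nnegrE -?lt0n//; lra.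
have t1 : 0 < 2 `^ tau - 1 :> R.
  by rewrite subr_gt0 /powR pnatr_eq0 /= expR_gt1 mulr_gt0// ln_gt0// ltr1n.
pose c1 := cK * ((2 `^ tau - 1) * cf).
have c10 : 0 < c1 by rewrite !mulr_gt0.
exists (c1 * v); first by rewrite mulr_gt0.
move=> x x0 xr; have xl := le_lt_trans xr rl.
have mI : measurable_fun setT (\1_A : 'rV[R]_n -> R) by exact: measurable_indic.
have I0 y : 0 <= (\1_A : 'rV[R]_n -> R) y by rewrite indicE ler0n.
rewrite -lee_fin EFinD (henon_eq_fold l0 x0) (kelvin_eq_fold l0 x0).
have -> : (c1 * v)%:E = (\int[mu]_y (c1 * \1_A y)%:E)%E.
  rewrite ge0_integralZl_rV ?(ltW c10)// integral_indic// setIT EFinM.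
  by congr (_ * _)%E; apply/esym; exact: volume_annulus.
rewrite -ge0_integralD_rV; last 4 first.
- by apply: measurable_fold; [exact: measurable_riesz|exact: measurable_riesz_kelvin].
- exact: measurable_funM.
- by move=> y; apply: fold_ge0; rewrite // ?riesz_ge0 ?riesz_kelvin_ge0.
- by move=> y; rewrite mulr_ge0// ltW.
apply: (@ge0_le_integral_rV_but _ _ _ _ x) => //.
- apply: measurable_funD; last exact: measurable_funM.
  by apply: measurable_fold; [exact: measurable_riesz|exact: measurable_riesz_kelvin].
- by apply: measurable_fold; [exact: measurable_riesz_kelvin|exact: measurable_riesz].
- move=> y; rewrite addr_ge0//; last exact: mulr_ge0 (ltW c10) (I0 y).
  by apply: fold_ge0; rewrite // ?riesz_ge0 ?riesz_kelvin_ge0.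
- by move=> y; apply: fold_ge0; rewrite // ?riesz_ge0 ?riesz_kelvin_ge0.
move=> y y0 yx.
have ny : 0 < enorm y by rewrite enorm_gt0.
have [yl|yl|yl] := ltgtP (enorm y) l; rewrite !(mul1r, mul0r, addr0, add0r); last 2 first.
- rewrite indicE memNset ?mulr0// /A /= => /andP[_]; lra.
- rewrite riesz_kelvin_sphere// indicE memNset ?mulr0 ?addr0// /A /= => /andP[_]; lra.
have hKK := riesz_kelvin_le l0 x0 xl (ltW yl) yx.
have hK0 := @riesz_kelvin_ge0 l x y l0.
have kelu := hl _ y0 yl.
have hg : (l / enorm y) `^ tau * henon y <= henon_kelvin l y.
  rewrite henon_kelvinE// ler_pM2l ?powR_gt0 ?divr_gt0// ler_pM2l ?powR_gt0//.
  by apply: ge0_ler_powR; rewrite ?nnegrE ?(ltW p0) ?(ltW (u0 y)) ?(ltW (kelvin_gt0 l0 y0)).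
have hg' : henon y <= henon_kelvin l y.
  apply: (le_trans _ hg); rewrite ler_peMl ?henon_ge0//.
  rewrite -[leLHS](powRr0 (l / enorm y)); apply: ler_powR; rewrite ?(ltW tau0)//.
  by rewrite ler_pdivlMr// mul1r ltW.
rewrite indicE; case: (boolP (y \in A)) => [|_]; last first.
  rewrite mulr0 addr0; nra.
rewrite inE /A /= => /andP[y4 y2].
rewrite mulr1.
have hKgap := hK x y x0 xr y2 yx.
have hfy : cf <= henon y by apply: hf; rewrite y4 ltW.
have hT : 2 `^ tau <= (l / enorm y) `^ tau.
  apply: ge0_ler_powR; rewrite ?nnegrE ?(ltW tau0) ?divr_ge0 ?(ltW l0) ?(ltW ny)//.
  by rewrite ler_pdivlMr//; lra.
have hgap : (2 `^ tau - 1) * cf <= henon_kelvin l y - henon y.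
  apply: (@le_trans _ _ ((2 `^ tau - 1) * henon y)); first by rewrite ler_pM2l.
  by rewrite mulrBl mul1r lerB// (le_trans _ hg)// ler_wpM2r// henon_ge0.
(* Expanding this product gives exactly the difference of the two folded integrands. *)
have : c1 <= (riesz x y - riesz_kelvin l x y) * (henon_kelvin l y - henon y).
  apply: ler_pM => //; rewrite ?mulr_ge0 ?(ltW cK0) ?(ltW t1) ?(ltW cf0)//.
  by rewrite lerBrDl.
rewrite mulrBl !mulrBr; lra.
Qed.

(** Initially [u] exceeds [kelvin l] by at most [M]. Each use of [le_kelvin_add] halves the excess,
    because [L] times the integral is at most 1/2. *)
Lemma le_kelvin_of_small l (M L : R) (D : set 'rV[R]_n) :
  0 < l -> 0 <= L -> measurable D ->
  (forall y, enorm y < l -> u y <= M) ->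
  (forall v w, 0 <= v -> v <= w -> w <= M -> w `^ p - v `^ p <= L * (w - v)) ->
  (forall y, y != 0 -> enorm y < l -> kelvin l y < u y -> D y) ->
  (forall x, x != 0 -> enorm x < l ->
    (L%:E * \int[mu]_y (\1_D y * (riesz x y * enorm y `^ a))%:E <= (1 / 2)%:E)%E) ->
  forall x, x != 0 -> enorm x < l -> u x <= kelvin l x.
Proof.
move=> l0 L0 mD uM Llip hD hsmall.
have M0 : 0 <= M by apply: (le_trans (ltW (u0 0))); apply: uM; rewrite enorm0.
have step : forall j x, x != 0 -> enorm x < l -> u x <= kelvin l x + M / 2 ^+ j.
  elim=> [|j IH] x x0 xl.
    rewrite expr0 divr1; have := uM _ xl; have := kelvin_gt0 l0 x0; lra.
  have S0 : 0 <= M / 2 ^+ j by rewrite divr_ge0.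
  have := le_kelvin_add l0 x0 xl S0 L0 mD uM Llip hD IH.
  rewrite -lee_fin EFinD => /le_trans; apply.
  rewrite leeD2l// (_ : M / 2 ^+ j.+1 = M / 2 ^+ j * (1 / 2)); last first.
    by rewrite exprS; field.
  have hs := hsmall x x0 xl.
  rewrite (mulrC L) EFinM -muleA [in leRHS]EFinM.
  by apply: lee_wpmul2l => //; rewrite lee_fin.
move=> x x0 xl; apply/ler_addgt0Pr => e e0.
(* Then [M / e < j + 1 <= 2^j]. *)
pose j := Num.truncn (M / e).
apply: (le_trans (step j x x0 xl)); rewrite lerD2l.
have : M / e < j.+1%:R by exact: truncnS_gt.
rewrite ltr_pdivrMr// => hM.
rewrite ler_pdivrMr ?exprn_gt0//; apply: (le_trans (ltW hM)); rewrite mulrC ler_pM2l//.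
by rewrite -natrX ler_nat ltn_expl.
Qed.

(** * Smallness of the weighted kernel on small balls and thin annuli *)

Hypothesis a0 : 0 < (n - k)%N%:R + a.

Let ler_pdivl_ereal (c x : R) (I : \bar R) : 0 < c ->
  (c%:E * I <= x%:E)%E -> (I <= (x / c)%:E)%E.
Proof.
by move=> c0 h; rewrite EFinM lee_pdivlMr// muleC.
Qed.

Let measurable_weighted (D : set 'rV[R]_n) x : measurable D ->
  measurable_fun setT (fun y : 'rV[R]_n => \1_D y * (riesz x y * enorm y `^ a)).
Proof.
move=> mD; apply: measurable_funM; first exact: measurable_indic.
apply: measurable_funM; [exact: measurable_riesz|exact: measurable_weight].
Qed.

Let indic_ge0 (D : set 'rV[R]_n) y : 0 <= (\1_D : 'rV[R]_n -> R) y.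
Proof. by rewrite indicE ler0n. Qed.

Let weighted_ge0 (D : set 'rV[R]_n) x y : 0 <= \1_D y * (riesz x y * enorm y `^ a).
Proof. exact: mulr_ge0 (indic_ge0 _ _) (mulr_ge0 (riesz_ge0 _ _) (powR_ge0 _ _)). Qed.

(* The bound on the unit ball comes for free from [u x < +oo] and [u >= m > 0]. *)
Lemma weighted_unit_ball : exists2 J, 0 < J & forall x, enorm x < 1 ->
  (\int[mu]_y (\1_[set z : 'rV[R]_n | (enorm z < 1)%R] y * (riesz x y * enorm y `^ a))%:E
     <= J%:E)%E.
Proof.
have [m [M [m0 hm]]] := ball_bounds ler01.
have mp : 0 < m `^ p by rewrite powR_gt0.
have M0 : 0 < M by have /andP[_] := hm 0 ltac:(by rewrite enorm0); exact: lt_le_trans.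
exists (M / m `^ p); first by rewrite divr_gt0.
move=> x x1; apply: ler_pdivl_ereal => //.
have mB : measurable [set z : 'rV[R]_n | enorm z < 1] by exact: measurable_ball0_rV.
have mW := measurable_weighted x mB.
rewrite -ge0_integralZl_rV ?(ltW mp)//.
apply: (@le_trans _ _ (u x)%:E); last first.
  by rewrite lee_fin; have /andP[] := hm x (ltW x1).
rewrite henon_eq; apply: ge0_le_integral_rV.
- exact: measurable_funM.
- by apply: measurable_funM; [exact: measurable_riesz|exact: measurable_henon].
- move=> y; exact: mulr_ge0 (ltW mp) (weighted_ge0 _ _ _).
- move=> y; rewrite indicE; case: (boolP (y \in _)) => [|_]; last first.
    by rewrite mul0r mulr0 mulr_ge0 ?riesz_ge0 ?henon_ge0.
  rewrite inE /= => y1; rewrite mul1r mulrCA ler_wpM2l ?riesz_ge0// mulrC.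
  rewrite ler_wpM2l ?powR_ge0//.
  have /andP[my _] := hm y (ltW y1).
  by apply: ge0_ler_powR; rewrite ?nnegrE ?(ltW p0) ?(ltW m0) ?(ltW (u0 y)).
Qed.

(** The dilation by [l] reduces the integral to the unit ball, with factor [l^(n-k+a)], a positive
    power of [l]. *)
Lemma weighted_small_ball e : 0 < e -> exists2 r, 0 < r &
  forall l x, 0 < l -> l <= r -> enorm x < l ->
  (\int[mu]_y (\1_[set z : 'rV[R]_n | (enorm z < l)%R] y * (riesz x y * enorm y `^ a))%:E
     <= e%:E)%E.
Proof.
move=> e0; have [J J0 hJ] := weighted_unit_ball.
pose b := (n - k)%N%:R + a.
have eJ : 0 < e / J by rewrite divr_gt0.
exists ((e / J) `^ b^-1); first by rewrite powR_gt0.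
move=> l x l0 lr xl.
have mB r : measurable [set z : 'rV[R]_n | enorm z < r] by exact: measurable_ball0_rV.
have mW := measurable_weighted x (mB l).
rewrite (ge0_integral_rV_affine 0 l0); last 2 first.
- exact/measurable_EFinP.
- by move=> y; rewrite lee_fin weighted_ge0.
have hx : enorm (l^-1 *: x) < 1.
  by rewrite enormZ gtr0_norm ?invr_gt0// mulrC ltr_pdivrMr// mul1r.
under eq_integral => y _.
  have -> : \1_[set z : 'rV[R]_n | enorm z < l] (l *: y + 0) *
      (riesz x (l *: y + 0) * enorm (l *: y + 0) `^ a) =
      (l `^ a / l ^+ k) * (\1_[set z : 'rV[R]_n | enorm z < 1] y *
        (riesz (l^-1 *: x) y * enorm y `^ a)).
    rewrite addr0 /riesz.
    have -> : x - l *: y = l *: (l^-1 *: x - y).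
      by rewrite scalerBr scalerA divff ?gt_eqF// scale1r.
    rewrite !enormZ gtr0_norm// powRM ?enorm_ge0 ?(ltW l0)// exprMn invfM !indicE.
    rewrite (_ : (l *: y \in _) = (y \in [set z : 'rV[R]_n | enorm z < 1])).
      by ring.
    by apply/idP/idP; rewrite !inE /= enormZ gtr0_norm// gtr_pMr.
  over.
have lak : 0 <= l `^ a / l ^+ k by rewrite divr_ge0 ?powR_ge0// exprn_ge0// ltW.
rewrite ge0_integralZl_rV//; last exact: measurable_weighted.
rewrite muleA -EFinM.
have hc : l ^+ n * (l `^ a / l ^+ k) = l `^ b.
  rewrite /b powRD; last by apply/implyP => _; rewrite gt_eqF.
  rewrite powR_mulrn ?(ltW l0)// -[in LHS](subnK (ltnW kn)) exprD.
  by field; rewrite expf_neq0 ?gt_eqF.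
have hb : l `^ b <= e / J.
  have -> : e / J = ((e / J) `^ b^-1) `^ b.
    by rewrite -powRrM mulVf ?powRr1 ?(ltW eJ)// gt_eqF.
  by apply: ge0_ler_powR; rewrite ?nnegrE ?powR_ge0 ?(ltW l0) ?(ltW a0).
rewrite hc; apply: (@le_trans _ _ ((l `^ b)%:E * J%:E)%E).
  by rewrite lee_wpmul2l ?lee_fin ?powR_ge0// hJ.
by rewrite -EFinM lee_fin -ler_pdivlMr.
Qed.

(** Translation and dilation move the ball to the unit ball around a fixed [x0] with [|x0| = 2].
    There [1 <= |y| <= 3], so [henon] is bounded below and the finiteness of [u x0] bounds the
    integral. *)
Lemma riesz_small_ball : exists2 J, 0 < J & forall x r, 0 < r ->
  (\int[mu]_y (\1_[set z : 'rV[R]_n | (enorm (x - z) < r)%R] y * riesz x y)%:E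
     <= (r ^+ (n - k) * J)%:E)%E.
Proof.
have [e e1] := unit_vector.
pose x0 := 2 *: e.
have nx0 : enorm x0 = 2 by rewrite enormZ e1 mulr1 ger0_norm.
have [c c0 hc] := @henon_ge 1 3 ltr01 ltac:(lra).
have mB x r : measurable [set z : 'rV[R]_n | enorm (x - z) < r].
  exact: measurable_ball_rV.
have mW x r : measurable_fun setT
    (fun y => \1_[set z : 'rV[R]_n | enorm (x - z) < r] y * riesz x y).
  by apply: measurable_funM; [exact: measurable_indic|exact: measurable_riesz].
have W0 x r y : 0 <= \1_[set z : 'rV[R]_n | enorm (x - z) < r] y * riesz x y.
  exact: mulr_ge0 (indic_ge0 _ _) (riesz_ge0 _ _).
have hJ : (\int[mu]_y (\1_[set z : 'rV[R]_n | (enorm (x0 - z) < 1)%R] y * riesz x0 y)%:E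
    <= (u x0 / c)%:E)%E.
  apply: ler_pdivl_ereal => //.
  rewrite -ge0_integralZl_rV ?(ltW c0)// henon_eq; apply: ge0_le_integral_rV.
  - exact: measurable_funM.
  - by apply: measurable_funM; [exact: measurable_riesz|exact: measurable_henon].
  - move=> y; exact: mulr_ge0 (ltW c0) (W0 _ _ _).
  - move=> y; rewrite indicE; case: (boolP (y \in _)) => [|_]; last first.
      by rewrite mul0r mulr0 mulr_ge0 ?riesz_ge0 ?henon_ge0.
    rewrite inE /= => y1; rewrite mul1r mulrC ler_wpM2l ?riesz_ge0// hc//.
    have h1 := lerB_enorm x0 y.
    have h2 := lerB_enorm y x0; rewrite enorm_distC in h2.
    apply/andP; split; lra.
exists (u x0 / c); first by rewrite divr_gt0.
move=> x r r0.
rewrite (ge0_integral_rV_affine (x - r *: x0) r0); last 2 first.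
- exact/measurable_EFinP.
- by move=> y; rewrite lee_fin.
under eq_integral => y _.
  have -> : \1_[set z : 'rV[R]_n | enorm (x - z) < r] (r *: y + (x - r *: x0)) *
      riesz x (r *: y + (x - r *: x0)) =
      (r ^+ k)^-1 * (\1_[set z : 'rV[R]_n | enorm (x0 - z) < 1] y * riesz x0 y).
    have xE : x - (r *: y + (x - r *: x0)) = r *: (x0 - y).
      by apply/rowP => i; rewrite !mxE; ring.
    rewrite /riesz xE enormZ gtr0_norm// exprMn invfM !indicE.
    rewrite (_ : (_ \in [set z | enorm (x - z) < r]) =
      (y \in [set z : 'rV[R]_n | enorm (x0 - z) < 1])); first by ring.
    by apply/idP/idP; rewrite !inE /= xE enormZ gtr0_norm// gtr_pMr.
  over.
have rk : 0 <= (r ^+ k)^-1 by rewrite invr_ge0 exprn_ge0// ltW.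
rewrite ge0_integralZl_rV// muleA -EFinM.
have -> : r ^+ n * (r ^+ k)^-1 = r ^+ (n - k).
  rewrite -[in LHS](subnK (ltnW kn)) exprD mulfK// expf_neq0// gt_eqF//.
by rewrite EFinM lee_wpmul2l// lee_fin exprn_ge0// ltW.
Qed.

(** The weight is at most [A] on the annulus. Near [x] the kernel has a small integral by
    [riesz_small_ball]; at distance at least [rho] it is at most [C / rho^k], and the volume of the
    annulus is of order [d]. *)
Lemma weighted_thin_annulus l e : 0 < l -> 0 < e ->
  exists d, [/\ 0 < d, d <= l / 2 & forall x,
  (\int[mu]_y (\1_[set z : 'rV[R]_n | (l - d <= enorm z < l + d)%R] y *
     (riesz x y * enorm y `^ a))%:E <= e%:E)%E].
Proof.
move=> l0 e0; have [J J0 hJ] := riesz_small_ball.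
pose A := (l / 2) `^ a + (2 * l) `^ a.
have A0 : 0 < A by rewrite addr_gt0 ?powR_gt0 ?divr_gt0 ?mulr_gt0.
have den : 0 < 2 * A * J + e by rewrite addr_gt0 ?mulr_gt0.
(* As [rho <= 1], [rho^(n-k) <= rho], and [2 A J rho <= e]. *)
pose rho := e / (2 * A * J + e).
have rho0 : 0 < rho by rewrite divr_gt0.
have rho1 : rho <= 1 by rewrite ler_pdivrMr// mul1r lerDr !mulr_ge0 ?ltW.
have rhoJ : A * (rho ^+ (n - k) * J) <= e / 2.
  have nk : (0 < n - k)%N by rewrite subn_gt0.
  have h1 : rho ^+ (n - k) <= rho.
    by rewrite -(prednK nk) exprS ler_piMr ?(ltW rho0)// exprn_ile1 ?(ltW rho0).
  have h2 : rho * (2 * A * J + e) = e by rewrite /rho divfK ?gt_eqF.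
  have h3 : 0 < A * J by rewrite mulr_gt0.
  have h4 : A * J * rho ^+ (n - k) <= A * J * rho by rewrite ler_pM2l.
  nra.
have n1 : 1 <= n%:R :> R by rewrite ler1n.
(* Applied to [t^n] on [[0, 2 l]], this bounds the volume of the annulus by [2 L d kappa]. *)
have [L L0 hL] := @powR_lipschitz R n%:R (2 * l) n1 (mulr_ge0 (ler0n R 2) (ltW l0)).
pose kappa := @unit_volume R n; have kappa0 : 0 < kappa by exact: unit_volume_gt0.
pose Q := A * (C / rho ^+ k) * kappa * L * 2.
have AC0 : 0 < A * (C / rho ^+ k) by rewrite mulr_gt0// divr_gt0// exprn_gt0.
have Q0 : 0 <= Q.
  by rewrite mulr_ge0// mulr_ge0// mulr_ge0// ?(ltW kappa0)// ltW.
exists (Num.min (l / 2) (e / (2 * (Q + 1)))).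
set d := Num.min _ _.
have d0 : 0 < d by rewrite lt_min !divr_gt0 ?mulr_gt0// ltr_wpDl.
have dl : d <= l / 2 by rewrite ge_min lexx.
split=> // x.
have Qd : Q * d <= e / 2.
  have hd : d <= e / (2 * (Q + 1)) by rewrite ge_min lexx orbT.
  have Q1 : 0 < Q + 1 by rewrite ltr_wpDl.
  have : (Q + 1) * d <= e / 2.
    apply: (@le_trans _ _ ((Q + 1) * (e / (2 * (Q + 1))))); first by rewrite ler_pM2l.
    by rewrite le_eqVlt; apply/orP; left; apply/eqP; field; rewrite gt_eqF.
  nra.
set D := [set z : 'rV[R]_n | _].
have mD : measurable D by exact: measurable_annulus.
pose B := [set z : 'rV[R]_n | enorm (x - z) < rho].
have mB : measurable B by exact: measurable_ball_rV.
have mBW : measurable_fun setT (fun y => \1_B y * riesz x y).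
  by apply: measurable_funM; [exact: measurable_indic|exact: measurable_riesz].
have mID : measurable_fun setT (\1_D : 'rV[R]_n -> R) by exact: measurable_indic.
have BW0 y : 0 <= \1_B y * riesz x y by exact: mulr_ge0 (indic_ge0 _ _) (riesz_ge0 _ _).
have AB0 y : 0 <= A * (\1_B y * riesz x y) by exact: mulr_ge0 (ltW A0) (BW0 y).
have AD0 y : 0 <= A * (C / rho ^+ k) * \1_D y by exact: mulr_ge0 (ltW AC0) (indic_ge0 _ _).
apply: (@le_trans _ _ (\int[mu]_y (A * (\1_B y * riesz x y) +
    A * (C / rho ^+ k) * \1_D y)%:E)%E).
  apply: ge0_le_integral_rV.
  - exact: measurable_weighted.
  - by apply: measurable_funD; exact: measurable_funM.
  - by move=> y; exact: weighted_ge0.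
  move=> y; rewrite [X in X * (_ * _) <= _]indicE; case: (boolP (y \in D)) => [yD|_]; last first.
    by rewrite mul0r addr_ge0.
  have hy : l - d <= enorm y < l + d by move: yD; rewrite inE.
  have hA : enorm y `^ a <= A.
    by apply: powR_le_ends; rewrite ?divr_gt0//; case/andP: hy => *; apply/andP; split; lra.
  rewrite mul1r indicE indicE yD mulr1.
  have rA : riesz x y * enorm y `^ a <= A * riesz x y.
    by rewrite mulrC ler_wpM2r// riesz_ge0.
  apply: (le_trans rA); case: (boolP (y \in B)) => [_|yB].
    by rewrite mul1r lerDl ltW.
  rewrite mul0r mulr0 add0r ler_pM2l// ler_pM2l//.
  have : rho <= enorm (x - y) by move: yB; rewrite notin_setE /B /= => /negP; rewrite -leNgt.
  move=> hr; rewrite lef_pV2 ?posrE ?exprn_gt0//; last exact: lt_le_trans hr.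
  by apply: lerXn2r; rewrite ?nnegrE ?enorm_ge0// ltW.
rewrite ge0_integralD_rV//; last 2 first.
- exact: measurable_funM.
- exact: measurable_funM.
rewrite !ge0_integralZl_rV ?(ltW A0) ?(ltW AC0)//.
have -> : (e%:E = (e / 2)%:E + (e / 2)%:E)%E by rewrite -EFinD; congr (_%:E); lra.
apply: leeD.
  apply: (@le_trans _ _ (A%:E * (rho ^+ (n - k) * J)%:E)%E).
    by rewrite lee_wpmul2l ?lee_fin ?(ltW A0)// hJ.
  by rewrite -EFinM lee_fin.
have hv : mu D = (((l + d) ^+ n - (l - d) ^+ n) * kappa)%:E.
  by apply: volume_annulus; lra.
rewrite [X in (_ * X <= _)%E](_ : _ = (((l + d) ^+ n - (l - d) ^+ n) * kappa)%:E); last first.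
  by rewrite integral_indic// setIT; exact: hv.
rewrite -EFinM lee_fin; apply: le_trans Qd.
have := hL (l - d) (l + d) ltac:(lra) ltac:(lra) ltac:(lra).
rewrite !powR_mulrn; [|lra|lra].
rewrite (_ : l + d - (l - d) = 2 * d); last by lra.
move=> hh; rewrite [leRHS](_ : _ = A * (C / rho ^+ k) * (L * (2 * d) * kappa)).
  by rewrite ler_pM2l// ler_pM2r.
by rewrite /Q; ring.
Qed.

(* Heine--Cantor for the dilations x |-> s^2 x with s close to 1. *)
Lemma dilation_uniform r e : 0 < e -> exists s0, [/\ 0 < s0, s0 < 1 &
  forall s x, s0 <= s -> s <= 1 -> enorm x <= r -> u x - e <= s ^+ k * u (s ^+ 2 *: x)].
Proof.
move=> e0; pose B := [set x : 'rV[R]_n | enorm x <= r].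
have /compact_near_coveringP cB : compact B := @enorm_closed_ball_compact R n r.
pose P (s : R) (x : 'rV[R]_n) := u x - e < s ^+ k * u (s ^+ 2 *: x).
have cX j : continuous (fun z : 'rV[R]_n * R => z.2 ^+ j).
  move=> z; apply: (@continuous_comp _ _ _ snd (fun t : R => t ^+ j)).
    exact: cvg_snd.
  exact: exprn_continuous.
pose Z (z : 'rV[R]_n * R) : 'rV[R]_n := z.2 ^+ 2 *: z.1.
have cZ : continuous Z.
  by move=> z; apply: cvgZ; [exact: cX|exact: cvg_fst].
have cG : continuous (fun z : 'rV[R]_n * R => z.2 ^+ k * u (z.2 ^+ 2 *: z.1) - u z.1).
  move=> z; apply: cvgB; last first.
    by apply: (@continuous_comp _ _ _ fst u); [exact: cvg_fst|exact: cu].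
  apply: cvgM; first exact: cX.
  exact: (@continuous_comp _ _ _ Z u z (cZ z) (@cu (Z z))).
have near1 : \forall s \near (1 : R), B `<=` P s.
  apply: (cB R (nbhs (1 : R)) P) => x _.
  have h : - e < (1 : R) ^+ k * u ((1 : R) ^+ 2 *: x) - u x.
    by rewrite !expr1n mul1r scale1r subrr oppr_lt0.
  have h2 := cvgr_gt _ (cG (x, 1)) (- e) h.
  by apply: filterS (h2 _) => z /=; rewrite /P; lra.
have /nbhs_ballP[d /= d0 hd] := near1.
exists (Num.max (1 / 2) (1 - d / 2)); split.
- by rewrite lt_max; apply/orP; left; lra.
- by rewrite gt_max; apply/andP; split; lra.
move=> s x hs s1 xr; apply/ltW; apply: (hd s) => //.
rewrite /ball /= ger0_norm ?subr_ge0//.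
have : 1 - d / 2 <= s by apply: le_trans hs; rewrite le_max lexx orbT.
lra.
Qed.

(** * Continuation in the radius of the sphere *)

Let below l := forall x, x != 0 -> enorm x < l -> u x <= kelvin l x.

(** Inversions in concentric spheres differ by a dilation. Together with [dilation_uniform] this
    carries estimates to nearby radii. *)
Lemma kelvin_dilation l l' x : 0 < l -> 0 < l' ->
  kelvin l x = (l' / l) ^+ k * kelvin l' ((l' / l) ^+ 2 *: x).
Proof.
move=> l0 l'0; rewrite /kelvin -inversion_scale// mulrA; congr (_ * _).
rewrite -exprMn enormZ ger0_norm ?sqr_ge0//; congr (_ ^+ _).
have [->|x0] := eqVneq (enorm x) 0; first by rewrite mulr0 invr0 !mulr0.
by field; rewrite x0 !gt_eqF.
Qed.

Section superlinear.
Hypothesis p1 : 1 <= p.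

(** Here [D] is the whole ball, on which [weighted_small_ball] makes the integral small. *)
Let below_small : exists2 r, 0 < r & forall l, 0 < l -> l <= r -> below l.
Proof.
have [m [M [m0 hm]]] := ball_bounds ler01.
have M0 : 0 < M by have /andP[_] := hm 0 ltac:(by rewrite enorm0); exact: lt_le_trans.
have [L L0 hL] := powR_lipschitz p1 (ltW M0).
have L1 : 0 < L + 1 by rewrite ltr_wpDl.
have e0 : 0 < 1 / (2 * (L + 1)) by rewrite divr_gt0// mulr_gt0.
have [r r0 hr] := weighted_small_ball e0.
exists (Num.min r 1); first by rewrite lt_min r0 ltr01.
move=> l l0; rewrite le_min => /andP[lr l1] x x0 xl.
apply: (@le_kelvin_of_small l M L [set z | enorm z < l]) => //.
- exact: measurable_ball0_rV.
- by move=> y yl; have /andP[] := hm y (ltW (lt_le_trans yl l1)).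
move=> y y0 yl; apply: (@le_trans _ _ (L%:E * (1 / (2 * (L + 1)))%:E)%E).
  by apply: lee_wpmul2l; rewrite ?lee_fin// hr.
rewrite -EFinM lee_fin mulrA mulr1 ler_pdivrMr ?mulr_gt0//; lra.
Qed.

(** For [s < 1] close to 1, [kelvin l x = s^k kelvin (s l) (s^2 x) >= s^k u (s^2 x) >= u x - e]. *)
Let below_limit l : 0 < l -> (forall l', 0 < l' -> l' < l -> below l') -> below l.
Proof.
move=> l0 hl x x0 xl; apply/ler_addgt0Pr => e e0.
have [s0 [s00 s01 hs]] := dilation_uniform (enorm x) e0.
pose s := s0.
have sl0 : 0 < s * l by rewrite mulr_gt0.
have sl : s * l < l by rewrite gtr_pMl.
rewrite (@kelvin_dilation l (s * l))// -mulrA mulfV ?mulr1 ?gt_eqF//.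
have h := hs s x (lexx _) (ltW s01) (lexx _).
rewrite -lerBlDr; apply: (le_trans h); rewrite ler_pM2l ?exprn_gt0//.
apply: hl => //; first by rewrite scaler_eq0 negb_or x0 expf_neq0 ?gt_eqF.
rewrite enormZ ger0_norm ?sqr_ge0// expr2 -mulrA ltr_pM2l//.
by apply: le_lt_trans xl; rewrite ger_pMl ?enorm_gt0 ?(ltW s01)// enorm_gt0.
Qed.

(** On the ball of radius [l - d] there is a margin [c], which survives a dilation close to the
    identity. So [kelvin l' < u] can occur only in a thin annulus, and [le_kelvin_of_small]
    applies. *)
Let below_open l : 0 < l -> below l -> exists2 e, 0 < e &
  forall l', l <= l' -> l' <= l + e -> below l'.
Proof.
move=> l0 hl.
have l2 : 0 <= 2 * l by rewrite mulr_ge0// ltW.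
have [m [M [m0 hm]]] := ball_bounds l2.
have M0 : 0 < M.
  by have /andP[_] := hm 0 ltac:(by rewrite enorm0); exact: lt_le_trans.
have [L L0 hL] := powR_lipschitz p1 (ltW M0).
have L1 : 0 < L + 1 by rewrite ltr_wpDl.
have e0 : 0 < 1 / (2 * (L + 1)) by rewrite divr_gt0// mulr_gt0.
have [d [d0 dl hd]] := weighted_thin_annulus l0 e0.
have ld0 : 0 < l - d by lra.
have ldl : l - d < l by lra.
have [c c0 hc] := kelvin_ge_add l0 ld0 ldl hl.
(* The margin shrinks to [s^k c], which is at least [c / 2^k] once [s >= 1/2]; the dilation may lose
   that much. *)
have c20 : 0 < c / 2 ^+ k by rewrite divr_gt0// exprn_gt0.
have [s0 [s00 s01 hs]] := dilation_uniform (l - d) c20.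
pose s1 := Num.max s0 (1 / 2).
have s10 : 0 < s1 by rewrite lt_max s00.
have s11 : s1 < 1 by rewrite gt_max s01; lra.
have ls : 0 < l / s1 - l.
  by rewrite subr_gt0 ltr_pdivlMr// gtr_pMr.
(* The first bound keeps [l'] below [l + d], the second keeps [l / l'] above [s1]. *)
exists (Num.min (d / 2) (l / s1 - l)); first by rewrite lt_min divr_gt0.
move=> l' ll' l'e.
have l'0 : 0 < l' by exact: lt_le_trans ll'.
have l'd : l' <= l + d / 2.
  by apply: (le_trans l'e); rewrite lerD2l ge_min lexx.
have l's : l' <= l / s1.
  by apply: (le_trans l'e); rewrite -lerBrDl ge_min lexx orbT.
pose s := l / l'.
have s1s : s1 <= s by rewrite /s ler_pdivlMr// mulrC -ler_pdivlMr.
have ss0 : 0 < s by rewrite divr_gt0.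
have s_1 : s <= 1 by rewrite ler_pdivrMr// mul1r.
have hD y : y != 0 -> enorm y < l' -> kelvin l' y < u y ->
    [set z | l - d <= enorm z < l + d] y.
  move=> y0 yl' hk /=; apply/andP; split; last by lra.
  rewrite leNgt; apply/negP => yld.
  have hs1 : s0 <= s by apply: le_trans s1s; rewrite le_max lexx.
  have h1 := hs s y hs1 s_1 (ltW yld).
  have sy0 : s ^+ 2 *: y != 0.
    by rewrite scaler_eq0 negb_or y0 expf_neq0 ?gt_eqF.
  have syl : enorm (s ^+ 2 *: y) <= l - d.
    rewrite enormZ ger0_norm ?sqr_ge0//; apply: le_trans (ltW yld).
    by rewrite ler_piMl ?enorm_ge0// exprn_ile1// ltW.
  have h2 := hc _ sy0 syl.
  have h3 : c / 2 ^+ k <= s ^+ k * c.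
    rewrite mulrC ler_pM2r// -exprVn; apply: lerXn2r; rewrite ?nnegrE ?(ltW ss0)//.
    have : 1 / 2 <= s by apply: le_trans s1s; rewrite le_max lexx orbT.
    by rewrite mul1r.
  move: hk; rewrite (@kelvin_dilation l' l)// -/s ltNge => /negP; apply.
  apply: (@le_trans _ _ (s ^+ k * (u (s ^+ 2 *: y) + c))); last first.
    by rewrite ler_pM2l ?exprn_gt0.
  rewrite mulrDr; lra.
move=> x x0 xl'.
apply: (@le_kelvin_of_small l' M L [set z | l - d <= enorm z < l + d]) => //.
- exact: measurable_annulus.
- by move=> y yl; have /andP[] := hm y ltac:(lra).
move=> y y0 yl; apply: (@le_trans _ _ (L%:E * (1 / (2 * (L + 1)))%:E)%E).
  by apply: lee_wpmul2l; rewrite ?lee_fin// hd.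
rewrite -EFinM lee_fin mulrA mulr1 ler_pdivrMr ?mulr_gt0//; lra.
Qed.

(** If the inequality failed for [l], then [l] would bound the set [E] of good initial intervals.
    Its supremum is good by [below_limit] and can be exceeded by [below_open]. *)
Lemma le_kelvin l x : 0 < l -> x != 0 -> enorm x < l -> u x <= kelvin l x.
Proof.
move=> l0; move: x; rewrite -/(below l); apply: contrapT => nPl.
pose E := [set t : R | 0 < t /\ forall s, 0 < s -> s <= t -> below s].
have [r r0 hr] := below_small.
have Er : E r by split.
have ubE : ubound E l.
  move=> t [t0 ht]; rewrite leNgt; apply/negP => lt; apply: nPl.
  by apply: ht => //; exact: ltW.
have supE : has_sup E by split; [exists r|exists l].
pose t := sup E.
have t0 : 0 < t by apply: (lt_le_trans r0); exact: (sup_upper_bound supE Er).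
have hlt s : 0 < s -> s < t -> below s.
  move=> s0 st.
  have ts : 0 < t - s by lra.
  have [z [z0 hz]] := sup_adherent ts supE.
  rewrite -/t => sz; apply: hz => //; lra.
have ht : below t by exact: below_limit.
have [e e0 he] := below_open t0 ht.
have : E (t + e).
  split; first lra.
  move=> s s0 ste; have [st|ts] := ltP s t; first exact: hlt.
  exact: he.
move/(sup_upper_bound supE); rewrite -/t; lra.
Qed.

(** For [|x| > 1] take the sphere of radius [sqrt |x|]: its inversion maps the unit vector [x / |x|]
    to [x], so [le_kelvin] reads [u (x / |x|) <= |x|^(k/2) u x]. *)
Lemma solution_decay : exists2 m, 0 < m & forall r x, 1 <= r ->
  enorm x <= r -> m / Num.sqrt r ^+ k <= u x.
Proof.
have [m [M [m0 hm]]] := ball_bounds ler01.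
exists m => // r x r1 xr.
have sr : 1 <= Num.sqrt r by rewrite -[1]sqrtr1 ler_wsqrtr.
have srk : 1 <= Num.sqrt r ^+ k by exact: exprn_ege1.
have sr0 : 0 < Num.sqrt r by exact: lt_le_trans sr.
have [x1|x1] := leP (enorm x) 1.
  have /andP[mu_ _] := hm x x1; apply: le_trans mu_.
  by rewrite ler_pdivrMr ?exprn_gt0// ler_peMr// ltW.
have nx : 0 < enorm x by lra.
pose e := (enorm x)^-1 *: x.
have e1 : enorm e = 1 by rewrite enormZ gtr0_norm ?invr_gt0// mulVf ?gt_eqF.
pose l := Num.sqrt (enorm x).
have l2 : l ^+ 2 = enorm x by rewrite sqr_sqrtr ?enorm_ge0.
have l0 : 0 < l by rewrite sqrtr_gt0.
have l1 : 1 < l by rewrite -[1]sqrtr1 ltr_sqrt.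
have eneq : e != 0 by rewrite -enorm_gt0 e1.
have := @le_kelvin l e l0 eneq; rewrite e1 => /(_ l1).
rewrite /kelvin e1 divr1 /inversion e1 expr1n divr1 l2 scalerA mulfV ?gt_eqF// scale1r.
have /andP[me _] := hm e ltac:(by rewrite e1).
move=> h; rewrite ler_pdivrMr ?exprn_gt0//.
apply: (le_trans me); apply: (le_trans h); rewrite mulrC ler_pM2l//.
by apply: lerXn2r; rewrite ?nnegrE ?sqrtr_ge0// ler_wsqrtr.
Qed.

End superlinear.

(** Only the annulus [r/2 <= |y| < r] is kept: its volume is of order [r^n], the weight at least of
    order [r^a], and the kernel at least [C / (2 r)^k]. *)
Lemma solution_growth : exists2 c, 0 < c & forall r v x, 0 < r -> 0 <= v ->
  (forall y, enorm y <= r -> v <= u y) -> enorm x <= r ->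
  c * r `^ ((n - k)%N%:R + a) * v `^ p <= u x.
Proof.
pose D := (1 / 2) `^ (- a) + 1 : R.
have D0 : 0 < D by rewrite addr_gt0 ?powR_gt0// divr_gt0.
pose E := (1 - (1 / 2) ^+ n) * @unit_volume R n.
have E0 : 0 < E.
  rewrite mulr_gt0 ?unit_volume_gt0// subr_gt0 exprn_ilt1 -?lt0n//; lra.
exists (C / 2 ^+ k * D^-1 * E).
  by rewrite mulr_gt0// mulr_gt0 ?invr_gt0// divr_gt0// exprn_gt0.
move=> r v x r0 v0 hv xr.
pose A := [set y : 'rV[R]_n | r / 2 <= enorm y < r].
have mA : measurable A by exact: measurable_annulus.
have muA : mu A = (r ^+ n * E)%:E.
  rewrite [LHS]volume_annulus; [|lra|lra].
  by rewrite /E mulrA mulrBr mulr1 -exprMn (_ : r * (1 / 2) = r / 2)//; field.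
pose c := C / (2 * r) ^+ k * (r `^ a * D^-1 * v `^ p).
have c0 : 0 <= c.
  rewrite mulr_ge0 ?divr_ge0 ?(ltW C0) ?exprn_ge0 ?mulr_ge0 ?powR_ge0 ?(ltW r0)//.
  by rewrite invr_ge0 ltW.
have h : (c%:E * mu A <= (u x)%:E)%E.
  rewrite henon_eq; apply: (@integral_rV_ge_cst _ _ _ x) => //.
  - by apply: measurable_funM; [exact: measurable_riesz|exact: measurable_henon].
  - by move=> y; exact: mulr_ge0 (riesz_ge0 _ _) (henon_ge0 _).
  move=> y /= /andP[yl yr] yx; apply: ler_pM.
  - by rewrite divr_ge0 ?(ltW C0)// exprn_ge0// mulr_ge0// ltW.
  - by rewrite mulr_ge0 ?powR_ge0// mulr_ge0 ?powR_ge0// invr_ge0 ltW.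
  - have dxy : 0 < enorm (x - y) by rewrite enorm_gt0 subr_eq0 eq_sym.
    have h2 : enorm (x - y) <= 2 * r by have := ler_enormB x y; lra.
    rewrite ler_pM2l// lef_pV2 ?posrE ?exprn_gt0//; last by rewrite mulr_gt0.
    by apply: lerXn2r; rewrite ?nnegrE ?enorm_ge0// mulr_ge0// ltW.
  - apply: ler_pM; rewrite ?mulr_ge0 ?powR_ge0 ?invr_ge0 ?(ltW D0)//.
      have -> : r `^ a * D^-1 = ((r / 2) `^ (- a) + r `^ (- a))^-1.
        have -> : r / 2 = r * (1 / 2) by field.
        rewrite powRM ?(ltW r0)//.
        have -> : r `^ (- a) * (1 / 2) `^ (- a) + r `^ (- a) = r `^ (- a) * D.
          by rewrite /D; ring.
        by rewrite invfM powRN invrK.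
      by apply: powR_ge_ends; [lra|apply/andP; split; lra].
    have vu : v <= u y by apply: hv; exact: ltW.
    by apply: ge0_ler_powR; rewrite ?nnegrE ?(ltW p0) ?(le_trans v0 vu).
move: h; rewrite muA -EFinM lee_fin; apply: le_trans.
rewrite powRD; last by apply/implyP => _; rewrite gt_eqF.
rewrite powR_mulrn ?(ltW r0)// /c.
rewrite -[X in r ^+ X * E](subnK (ltnW kn)) exprD exprMn.
rewrite le_eqVlt; apply/orP; left; apply/eqP; field.
by rewrite !expf_neq0 ?gt_eqF.
Qed.

Lemma no_positive_solution : False.
Proof.
have [c c0 hc] := solution_growth.
pose b := (n - k)%N%:R + a.
(* [z] is a minimum point on the ball, and the growth estimate is applied with [v = u z] at [z]
   itself. *)
have umin r : 1 <= r -> exists z, [/\ enorm z <= r, u z <= u 0 & c * r `^ b * u z `^ p <= u z].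
  move=> r1; have r0 : 0 < r by exact: lt_le_trans r1.
  have B0 : [set x : 'rV[R]_n | enorm x <= r] !=set0.
    by exists 0; rewrite /= enorm0 ltW.
  have cuB : {within [set x : 'rV[R]_n | enorm x <= r], continuous u}.
    exact: continuous_subspaceT.
  have [z] := compact_EVT_min B0 (@enorm_closed_ball_compact R n r) cuB.
  rewrite inE /= => zr hz; exists z; split=> //.
    by apply: hz; rewrite inE /= enorm0 ltW.
  by apply: hc => //; [exact: ltW|move=> y yr; apply: hz; rewrite inE].
have powS (v s t : R) : 0 < v -> v `^ s * v `^ t = v `^ (s + t).
  by move=> v0; rewrite powRD//; apply/implyP => _; rewrite gt_eqF.
(* For [p <= 1], division by [u z ^ p] bounds [c r^b] by [u 0 ^ (1 - p)] for every [r >= 1]. *)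
have [p1|/ltW p1] := leP p 1.
  have [r r1 hr] := powR_unbounded (u 0 `^ (1 - p) / c) a0.
  have [z [zr z0 hz]] := umin r r1.
  have : c * r `^ b <= u z `^ (1 - p).
    rewrite -(@ler_pM2r _ (u z `^ p)) ?powR_gt0// powS//.
    by rewrite subrK powRr1 ?(ltW (u0 z)).
  have : u z `^ (1 - p) <= u 0 `^ (1 - p).
    by apply: ge0_ler_powR; rewrite ?nnegrE ?subr_ge0 ?(ltW (u0 _)).
  by move: hr; rewrite ltr_pdivrMr// -/b mulrC; lra.
have [m m0 hm] := solution_decay p1.
(* Inserting the decay bound into the growth estimate leaves the exponent
   [b - (k / 2) (p - 1) = tau / 2], so [r^(tau/2)] would stay bounded. *)
have tau2 : 0 < tau / 2 by rewrite divr_gt0.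
have [r r1 hr] := powR_unbounded ((c * m `^ (p - 1))^-1) tau2.
have r0 : 0 < r by exact: lt_le_trans r1.
have [z [zr _ hz]] := umin r r1.
have := hm r z r1 zr.
have -> : m / Num.sqrt r ^+ k = m * r `^ (- (k%:R / 2)).
  rewrite -powR12_sqrt ?(ltW r0)// -powR_mulrn ?powR_ge0// -powRrM powRN.
  by rewrite [_ * k%:R]mulrC.
move=> hmz.
have mr0 : 0 < m * r `^ (- (k%:R / 2)) by rewrite mulr_gt0// powR_gt0.
have : c * r `^ b * u z `^ (p - 1) <= 1.
  rewrite -(@ler_pM2r _ (u z))// mul1r -(mulrA (c * _)).
  have -> : u z `^ (p - 1) * u z = u z `^ p.
    by rewrite -[X in _ * X]powRr1 ?(ltW (u0 z))// powS// subrK.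
  exact: hz.
have : (m * r `^ (- (k%:R / 2))) `^ (p - 1) <= u z `^ (p - 1).
  by apply: ge0_ler_powR; rewrite ?nnegrE ?subr_ge0 ?(ltW (u0 _)) ?(ltW mr0).
rewrite powRM ?powR_ge0 ?(ltW m0)// -powRrM => h1 h2.
have : c * m `^ (p - 1) * r `^ (tau / 2) <= 1.
  apply: le_trans h2; apply: (@le_trans _ _ (c * r `^ b *
      (m `^ (p - 1) * r `^ (- (k%:R / 2) * (p - 1))))); last first.
    by rewrite ler_pM2l// mulr_gt0// powR_gt0.
  have -> : tau / 2 = b + - (k%:R / 2) * (p - 1).
    rewrite /tau /b natrB ?(leq_trans (ltnW kn)) ?leq_pmull// natrB ?(ltnW kn)//.
    by rewrite natrM; field.
  by rewrite -(powS r b _ r0) le_eqVlt; apply/orP; left; apply/eqP; ring.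
have cm0 : 0 < c * m `^ (p - 1) by rewrite mulr_gt0// powR_gt0.
by move: hr; rewrite -[X in X < _]mul1r ltr_pdivrMr// mulrC; lra.
Qed.

End scaling_spheres.

Unset Implicit Arguments.

Theorem theorem1p6 (R : realType) (m n : nat) (a p C : R) (u : 'rV[R]_n -> R) :
  (1 <= m)%N -> (m%:R < n%:R / 2 :> R) ->
  - (2 * m%:R) < a ->
  0 < p -> p < (n%:R + 2 * m%:R + 2 * a) / (n%:R - 2 * m%:R) ->
  is_normalizing_constant n m C ->
  continuous u -> (forall x, 0 <= u x) ->
  (forall x, (u x)%:E =
     \int[lebesgue_rV R n]_y
       (C / enorm (x - y) ^+ (n - 2 * m) * enorm y `^ a * u y `^ p)%:E)%E ->
  forall x, u x = 0.
Proof.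
move=> m1 mn a2 p0 ptau [C0 _] cu u_ge0 ueq.
pose k := (n - 2 * m)%N.
have m2n : (2 * m < n)%N by rewrite -(ltr_nat R) natrM; lra.
have kE : k%:R = n%:R - 2 * m%:R :> R by rewrite /k natrB ?(ltnW m2n)// natrM.
have k0 : (0 < k)%N by rewrite subn_gt0.
have kn : (k < n)%N by rewrite /k ltn_subrL muln_gt0 m1 (leq_trans _ m2n).
have kR0 : 0 < k%:R :> R by rewrite ltr0n.
(* Subcriticality with the denominator cleared, since [2n - k = n + 2m]. *)
have tau0 : 0 < (2 * n - k)%N%:R + 2 * a - k%:R * p.
  rewrite natrB ?(leq_trans (ltnW kn)) ?leq_pmull// natrM.
  move: ptau; rewrite -kE ltr_pdivlMr// => ptau.
  by rewrite mulrC; move: kE ptau; lra.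
(* This is [a > -2m], since [n - k = 2m]. *)
have a0 : 0 < (n - k)%N%:R + a.
  by rewrite natrB ?(ltnW kn)//; move: kE a2; lra.
have henon_eq x : ((u x)%:E =
    \int[lebesgue_rV R n]_y (@riesz R n k C x y * @henon R n a p u y)%:E)%E.
  by rewrite ueq; apply: eq_integral => y _; rewrite /riesz /henon mulrA.
move=> x; apply: contrapT => ux.
have ux0 : 0 < u x by rewrite lt0r u_ge0 andbT; exact/eqP.
have u0 := solution_gt0 kn C0 p0 cu henon_eq ux0.
exact: (no_positive_solution k0 kn C0 p0 cu henon_eq u0 tau0 a0).
Qed.
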